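(* The following statements are equivalent (in ZFC): (1) There is a Corson compactum $X$ such that $X^\omega$ is ccc but $X^\omega$ does not have a dense metrizable subspace. (2) There is a compact space $X$ such that $X^\omega$ is ccc and $X^\omega$ can be covered by $\omega_1$ nowhere dense subsets. (3) $MA_{\omega_1}$ for powerfully ccc posets fails. (4) There is a ccc Corson compactum $X$ of weight $\omega_1$ such that $X^\omega$ does not have a dense metrizable subspace.
   Context: A compact Hausdorff space $X$ is a Corson compactum if for some cardinal $\kappa$ it is homeomorphic to a subspace of $\Sigma(\mathbb{R}^\kappa)=\{x \in \mathbb{R}^\kappa : |\{\alpha<\kappa: x(\alpha)\neq 0\}| \leq \aleph_0\}$. A space (or poset) is ccc if every family of pairwise disjoint non-empty open sets (resp. every antichain) is countable. A poset $\mathbb{P}$ is powerfully ccc if every finite power $\mathbb{P}^n$ (with the coordinatewise order) is ccc. $MA_{\omega_1}$ for powerfully ccc posets is the statement: for every powerfully ccc poset $\mathbb{P}$ and every family of $\aleph_1$ dense subsets of $\mathbb{P}$ there is a filter on $\mathbb{P}$ meeting all of them.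
   Formalization: In (2), ''compact space'' is taken to mean a nonempty compact Hausdorff space; otherwise (2) would hold trivially in ZFC, for the empty space or for ω_1 with the cofinite topology. *)

(* Defs.v *)
From HB Require Import structures.
From Stdlib Require Import Rdefinitions.
From mathcomp Require Import all_boot all_order all_algebra.
From mathcomp Require Import all_classical all_reals.
From mathcomp Require Import topology.
From mathcomp Require Import Rstruct Rstruct_topology.

Set Implicit Arguments.
Unset Strict Implicit.
Unset Printing Implicit Defensive.

Import Order.TTheory GRing.Theory Num.Theory.
Local Open Scope classical_set_scope.
Local Open Scope ring_scope.

(** |A| <= aleph_1 : A carries a well-order all of whose proper initial
    segments are countable. *)
Definition card_le_aleph1 {I : Type} (A : set I) : Prop :=
  exists lt : I -> I -> Prop,
    (forall i, A i -> ~ lt i i) /\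
    (forall i j k, A i -> A j -> A k -> lt i j -> lt j k -> lt i k) /\
    (forall i j, A i -> A j -> [\/ lt i j, i = j | lt j i]) /\
    (forall B : set I, B `<=` A -> B !=set0 ->
       exists2 b, B b & forall c, B c -> ~ lt c b) /\
    (forall i, A i -> countable [set j | A j /\ lt j i]).

Definition ccc_space (T : topologicalType) : Prop :=
  forall F : set (set T),
    (forall U, F U -> open U /\ U !=set0) ->
    (forall U V, F U -> F V -> U <> V -> U `&` V = set0) ->
    countable F.

Definition nowhere_dense (T : topologicalType) (A : set T) : Prop :=
  interior (closure A) = set0.

Definition metrizable_subspace (T : topologicalType) (D : set T) : Prop :=
  exists d : T -> T -> R,
    (forall x y, D x -> D y -> (d x y = 0 <-> x = y)) /\
    (forall x y, D x -> D y -> d x y = d y x) /\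
    (forall x y z, D x -> D y -> D z -> d x z <= d x y + d y z) /\
    (forall U : set T,
       (exists V : set T, open V /\ U = D `&` V) <->
       (U `<=` D /\ forall x, U x ->
          exists2 e : R, 0 < e & [set y | D y /\ d x y < e] `<=` U)).

Definition corson_compact (X : topologicalType) : Prop :=
  compact [set: X] /\ hausdorff_space X /\
  exists (K : Type) (e : X -> {ptws K -> R}),
    continuous e /\ injective e /\
    (forall U : set X, open U ->
       exists2 V : set {ptws K -> R}, open V & e @` U = range e `&` V) /\
    (forall x, countable [set k | e x k <> 0]).

Definition weight_aleph1 (X : topologicalType) : Prop :=
  (exists B : set (set X), card_le_aleph1 B /\ basis B) /\ ~ @second_countable X.

(** Posets, ccc, powerfully ccc, Martin's axiom. Convention: q <= p means
    q is stronger than p. *)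
Definition partial_order {P : Type} (le : P -> P -> Prop) : Prop :=
  (forall p, le p p) /\
  (forall p q, le p q -> le q p -> p = q) /\
  (forall p q r, le p q -> le q r -> le p r).

Definition compatible {P : Type} (le : P -> P -> Prop) (p q : P) : Prop :=
  exists r, le r p /\ le r q.

Definition antichain {P : Type} (le : P -> P -> Prop) (A : set P) : Prop :=
  forall p q, A p -> A q -> p <> q -> ~ compatible le p q.

Definition ccc_poset {P : Type} (le : P -> P -> Prop) : Prop :=
  forall A : set P, antichain le A -> countable A.

Definition power_le {P : Type} (le : P -> P -> Prop) (n : nat)
  (f g : 'I_n -> P) : Prop := forall i, le (f i) (g i).

Definition powerfully_ccc {P : Type} (le : P -> P -> Prop) : Prop :=
  forall n : nat, ccc_poset (@power_le P le n).

Definition dense_in {P : Type} (le : P -> P -> Prop) (D : set P) : Prop :=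
  forall p, exists2 q, D q & le q p.

Definition poset_filter {P : Type} (le : P -> P -> Prop) (G : set P) : Prop :=
  G !=set0 /\
  (forall p q, G p -> le p q -> G q) /\
  (forall p q, G p -> G q -> exists2 r, G r & le r p /\ le r q).

Definition MA_aleph1_powerfully_ccc : Prop :=
  forall (P : Type) (le : P -> P -> Prop),
    inhabited P -> partial_order le -> powerfully_ccc le ->
    forall Ds : set (set P), card_le_aleph1 Ds ->
      (forall D, Ds D -> dense_in le D) ->
      exists G : set P, poset_filter le G /\
        forall D, Ds D -> G `&` D !=set0.

(* Main.v *)
(** Proof idea.  Under [MA], the open subsets of [X^omega], a ccc power, form a powerfully ccc
    poset, so [X^omega] is not covered by aleph_1 nowhere dense sets, and
    uncountably many nonempty open sets have uncountable subfamilies with a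
    common point.  A Corson [X^omega] therefore has only countably many active
    coordinates, hence a sigma-disjoint pi-base, and a tree of pointed open sets
    following this pi-base carries a dense metrizable subspace.  If [X^omega] is
    not ccc but [X] has weight aleph_1, a sigma-disjoint pi-base is obtained by
    multiplying boxes with shifted copies of a disjoint family of size aleph_1.

    From the failure of [MA] (Todorcevic-Velickovic): some hereditary family [K]
    of finite subsets of an index set [I] of size aleph_1 contains all singletons,
    is ccc in all finite powers, and has no uncountable homogeneous set.
    Contrapositively, if every such [K] has an uncountable homogeneous set, then
    suitable [K] yield in turn: domination of aleph_1 functions, pseudo-intersections,
    sigma-centeredness of powerfully ccc posets of size aleph_1, and (with Bell's
    argument and a Loewenheim-Skolem closure) [MA] itself.  The space [X] of subsets
    of [I] all of whose finite subsets lie in [K] is a Corson compactum; its power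
    is ccc because two boxes of the same type over injected reals [r i] can only
    conflict in [K], but it is not separable, whereas a dense metrizable subspace
    would make it so. *)
Require Import Defs.
From Stdlib Require Import Rdefinitions.
From mathcomp Require Import all_boot all_order all_algebra.
From mathcomp Require Import all_classical all_reals.
From mathcomp Require Import topology.
From mathcomp Require Import Rstruct Rstruct_topology.
From mathcomp Require Import zify lra.
Local Open Scope classical_set_scope.

Set Implicit Arguments.
Unset Strict Implicit.
Unset Printing Implicit Defensive.
Import Order.TTheory GRing.Theory Num.Theory.

(** * Countability and small index sets *)

(** The way from families [K] back to Martin's axiom is shaped by one obstacle: the union of two
    conditions must again be a condition, although a countable type, or one use of the ccc of a
    finite power, controls only finitely many levels. Each family therefore leaves slack at the
    higher levels: [n.+1] values for domination, two points instead of one for pseudo-intersections,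
    [n.+1] lower bounds for centeredness. The slack is removed afterwards, on the uncountable
    homogeneous set: finitely many values are bounded, the two points are dealt with by a case
    distinction, and compactness turns the lower bounds into centered pieces. The passage from an
    uncountable subset of [I] to all of the aleph_1 many objects rests on [small]: each object is
    seen by all but countably many indices, hence by some index of any uncountable set. *)

Lemma uncountable_avoid (T : Type) (Z C : set T) :
  ~ countable Z -> countable C -> exists2 z, Z z & ~ C z.
Proof.
move=> uZ cC; apply: contrapT => h; apply: uZ.
apply: sub_countable cC; apply: subset_card_le => z Zz.
by apply: contrapT => nCz; apply: h; exists z.
Qed.

Lemma countable_setU (T : Type) (A B : set T) :
  countable A -> countable B -> countable (A `|` B).
Proof.
move=> cA cB; rewrite -bigcup2E; apply: bigcup_countable => // -[|[|i]] _ //=.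
Qed.

Lemma countable_sub (T : Type) (A B : set T) :
  A `<=` B -> countable B -> countable A.
Proof. by move=> /subset_card_le AB; apply: sub_countable. Qed.

Lemma countable_preimage_inj (T U : Type) (f : T -> U) (A : set T) (B : set U) :
  (forall x y, A x -> A y -> f x = f y -> x = y) ->
  (forall x, A x -> B (f x)) -> countable B -> countable A.
Proof.
move=> fi AB /countable_injP[g gi]; apply/countable_injP; exists (g \o f).
move=> x y; rewrite !inE => Ax Ay /= e; apply: fi => //.
by apply: gi => //; rewrite inE; apply: AB.
Qed.

Lemma uncountable_fiber (T U : Type) (f : T -> U) (A : set T) (B : set U) :
  ~ countable A -> countable B -> (forall x, A x -> B (f x)) ->
  exists2 u, B u & ~ countable [set x | A x /\ f x = u].
Proof.
move=> uA cB AB; apply: contrapT => h; apply: uA.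
apply: (@countable_sub _ _ (\bigcup_(u in B) [set x | A x /\ f x = u])).
  by move=> x Ax; exists (f x) => //; exact: AB.
apply: bigcup_countable => // u Bu; apply: contrapT => nc.
by apply: h; exists u.
Qed.

Lemma uncountable_two (T : Type) (A : set T) : ~ countable A ->
  exists x y, [/\ A x, A y & x <> y].
Proof.
move=> uA; have [x Ax _] := uncountable_avoid uA (countable0 T).
have [y Ay nxy] := uncountable_avoid uA (countable1 x).
by exists x, y; split => // e; apply: nxy; rewrite e.
Qed.

Lemma uncountable_type (T : Type) (U : countType) (f : T -> U) (A : set T) :
  ~ countable A -> exists u, ~ countable [set x | A x /\ f x = u].
Proof.
move=> uA; have [//|//|u _ h] := @uncountable_fiber _ _ f A [set: U] uA.
by exists u.
Qed.

Lemma countable_allseq (T : Type) (A : set T) : countable A ->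
  countable [set l : seq T | forall n, n < size l -> exists2 x, A x & onth l n = Some x].
Proof.
move=> /countable_injP[f fi].
apply: (@countable_preimage_inj _ (seq nat) (map f) _ setT) => //.
elim=> [|x l IH] [|y m] // hl hm /= [exy elm]; congr (_ :: _).
  have [x' Ax' /= [e1]] := hl 0 isT; have [y' Ay' /= [e2]] := hm 0 isT.
  by apply: fi => //; rewrite inE ?e1 ?e2.
by apply: IH => // n hn; [exact: (hl n.+1)|exact: (hm n.+1)].
Qed.

(* For uncountable [I], this is how |S| <= |I| = aleph_1 is used: with [I] well-ordered
   in type omega_1, [W d] consists of the first elements of [S], up to [d]. *)
Definition small (I S : Type) : Prop := exists W : I -> set S,
  (forall d, countable (W d)) /\ (forall s, countable [set d | ~ W d s]).

(** Coding each countable [W d] by numbers makes the objects of code at most [n] a finite set. Codes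
    of different indices are unrelated; each use refers to one index [d] that sees the objects in
    question. *)
Lemma small_enum (I S : Type) : small I S ->
  exists (W : I -> set S) (e : I -> S -> nat),
  (forall d s t, W d s -> W d t -> e d s = e d t -> s = t) /\
  (forall s, countable [set d | ~ W d s]).
Proof.
move=> [W [cW Ws]]; exists W.
have /choice[e he] : forall d, exists f : S -> nat,
    forall s t, W d s -> W d t -> f s = f t -> s = t.
  move=> d; have /countable_injP[f fi] := cW d; exists f => s t Wd Wt.
  by apply: fi; rewrite inE.
by exists e.
Qed.

Lemma small_sum (I S T : Type) : small I S -> small I T -> small I (S + T).
Proof.
move=> [W [cW Ws]] [V [cV Vs]].
exists (fun d => [set x | match x with inl s => W d s | inr t => V d t end]).
split=> [d|[s|t]]; [|exact: Ws|exact: Vs].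
rewrite (_ : [set x | _] = (inl @` W d) `|` (inr @` V d)).
  apply: countable_setU.
    exact: sub_countable (card_image_le _ _) (cW d).
  exact: sub_countable (card_image_le _ _) (cV d).
apply/seteqP; split=> [[s|t] /= h|[s|t] /= [] [x h] // [<-] //].
  by left; exists s.
by right; exists t.
Qed.

Lemma small_prod (I S T : Type) : small I S -> small I T -> small I (S * T).
Proof.
move=> [W [cW Ws]] [V [cV Vs]]; exists (fun d => W d `*` V d); split=> [d|[s t]].
  exact: countableX.
apply: countable_sub (countable_setU (Ws s) (Vs t)) => d /= h.
by apply: contrapT => /not_orP[/contrapT a /contrapT b]; apply: h.
Qed.

Lemma small_seq (I S : Type) : small I S -> small I (seq S).
Proof.
move=> [W [cW Ws]].
exists (fun d => [set l | forall n, n < size l -> exists2 x, W d x & onth l n = Some x]).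
split=> [d|l]; first exact: countable_allseq.
elim: l => [|x l IH].
  by rewrite (_ : [set d | _] = set0) //; apply/seteqP; split=> // d; case.
apply: countable_sub (countable_setU (Ws x) IH) => d /= h.
apply: contrapT => /not_orP[/contrapT a /contrapT b]; apply: h => -[_|n] /=.
  by exists x.
exact: b.
Qed.

Section Families.
Variable I : choiceType.

(* Finite subsets of [I] are coded by sequences: for hereditary [K], membership depends
   only on the set of entries. *)
Definition hereditary (K : seq I -> Prop) :=
  forall a b, {subset a <= b} -> K b -> K a.

(** For hereditary [K] this is the ccc of all finite powers of [K] under reverse inclusion: two
    conditions have a common extension exactly if their concatenation is in [K]. Distinct sequences
    coding one set do no harm, being compatible. *)
Definition pccc_family (K : seq I -> Prop) :=
  forall N (G : set ('I_N -> seq I)), ~ countable G ->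
  (forall f, G f -> forall j, K (f j)) ->
  exists f g, [/\ G f, G g, f <> g & forall j, K (f j ++ g j)].

Definition homogeneous (K : seq I -> Prop) (Z : set I) :=
  forall a : seq I, (forall i, i \in a -> Z i) -> K a.

(** A precaliber property for posets of finite subsets of [I] alone. Martin's axiom for [I]-many
    dense sets is recovered from it, so a failure of the axiom refutes it. *)
Definition precaliber_families := forall K,
  hereditary K -> (forall i, K [:: i]) -> pccc_family K ->
  exists2 Z, ~ countable Z & homogeneous K Z.

(** Pigeonhole on types; finite powers cost nothing, because tuples of types are again countable in
    number. *)
Lemma typed_pccc_family (K : seq I -> Prop) (T : countType) (tau : seq I -> T) :
  (forall a b, K a -> K b -> tau a = tau b -> K (a ++ b)) -> pccc_family K.
Proof.
move=> h N G uG GK.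
have [t ut] := uncountable_type (fun f : 'I_N -> seq I => [ffun j => tau (f j)]) uG.
have [f [g [[Gf ft] [Gg gt] fg]]] := uncountable_two ut.
exists f, g; split=> // j; apply: h; [exact: GK|exact: GK|].
by have := ft; rewrite -gt => /ffunP/(_ j); rewrite !ffunE.
Qed.

End Families.

(** * Domination *)

Lemma finite_below_code (S : Type) (W : set S) (e : S -> nat) (n : nat) :
  (forall s t, W s -> W t -> e s = e t -> s = t) ->
  exists l : seq S, forall s, W s -> e s <= n -> List.In s l.
Proof.
move=> ei; elim: n => [|n [l hl]].
- have [[s [Ws es]]|h] := pselect (exists s, W s /\ e s = 0).
    by exists [:: s] => t Wt; rewrite leqn0 => /eqP et; left; apply: ei; rewrite ?es ?et.
  by exists [::] => t Wt; rewrite leqn0 => /eqP et; case: h; exists t.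
- have [[s [Ws es]]|h] := pselect (exists s, W s /\ e s = n.+1).
    exists (s :: l) => t Wt; rewrite leq_eqVlt ltnS => /orP[/eqP et|et].
      by left; apply: ei; rewrite ?es ?et.
    by right; exact: hl.
  exists l => t Wt; rewrite leq_eqVlt ltnS => /orP[/eqP et|]; last exact: hl.
  by case: h; exists t.
Qed.

Lemma bounded_below_code (S : Type) (W : set S) (e g : S -> nat) (n : nat) :
  (forall s t, W s -> W t -> e s = e t -> s = t) ->
  exists b, forall s, W s -> e s <= n -> g s <= b.
Proof.
move=> ei; have [l hl] := finite_below_code n ei.
suff [b hb] : exists b, forall s, List.In s l -> g s <= b.
  by exists b => s Ws es; exact/hb/hl.
elim: l {hl} => [|t l [b hb]]; first by exists 0.
exists (maxn (g t) b) => s /= [<-|/hb sb]; rewrite leq_max ?leqnn //.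
by rewrite sb orbT.
Qed.

Section PrecaliberConsequences.
Variable I : choiceType.
Hypothesis PC : precaliber_families I.

(** The allowance of [n.+1] values at level [n] holds automatically for a union of two conditions
    once [n] is at least twice their size; below that level the type lists the values. *)
Lemma precaliber_bounded (f : I -> nat -> nat) :
  exists2 Z, ~ countable Z & forall n, exists b, forall d, Z d -> f d n <= b.
Proof.
pose K (a : seq I) := forall n, size (undup [seq f d n | d <- a]) <= n.+1.
have [|||Z uZ hZ] := PC (K := K).
- move=> a b ab Kb n; apply: leq_trans (Kb n).
  apply: uniq_leq_size; first exact: undup_uniq.
  move=> x; rewrite !mem_undup => /mapP[d da ->]; apply: map_f; exact: ab.
- by move=> i n.
- pose tau (a : seq I) :=
    (size a, [seq [seq f d n | d <- a] | n <- iota 0 (size a).*2]).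
  apply: (typed_pccc_family (tau := tau)) => a b Ka Kb [sab e] n.
  have [nlt|nge] := ltnP n (size a).*2.
    have eab : [seq f d n | d <- a] = [seq f d n | d <- b].
      have := congr1 (nth [::] ^~ n) e.
      by rewrite !(nth_map 0) ?size_iota -?sab // !nth_iota -?sab.
    apply: leq_trans (Ka n); apply: uniq_leq_size; first exact: undup_uniq.
    by move=> x; rewrite !mem_undup map_cat mem_cat -eab orbb.
  rewrite (leq_trans (size_undup _)) // size_map size_cat -sab addnn.
  exact: leq_trans nge _.
- exists Z => // n; apply: contrapT => nb.
  (* Unboundedness at [n] yields, one after another, members of [Z] with strictly larger values;
     [n.+2] of them violate [K]. *)
  have big k : exists a : seq I, [/\ (forall i, i \in a -> Z i), size a = k &
       uniq [seq f d n | d <- a]].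
    elim: k => [|k [a [aZ sa ua]]]; first by exists [::].
    have [d [Zd fd]] : exists d, Z d /\ forall i, i \in a -> f i n < f d n.
      apply: contrapT => h; apply: nb; exists (\max_(i <- a) f i n) => d Zd.
      rewrite leqNgt; apply/negP => lt; apply: h; exists d; split=> // i ia.
      apply: leq_ltn_trans lt; exact: (@leq_bigmax_seq _ _ xpredT (fun i => f i n)).
    exists (d :: a); split=> /=; [|by rewrite sa|].
      by move=> i; rewrite inE => /orP[/eqP->//|/aZ].
    rewrite ua andbT; apply/negP => /mapP[i /fd lt e].
    by rewrite e ltnn in lt.
  have [a [aZ sa ua]] := big n.+2.
  by have := hZ a aZ n; rewrite undup_id // size_map sa ltnn.
Qed.

(** Each [f d] dominates, by diagonalisation, the countably many [g s] with [s] in [W d]. A common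
    bound of the [f d] with [d] in [Z] then dominates every [g s], since [Z] contains an index that
    sees [s]. *)
Lemma precaliber_dominating (S : Type) (g : S -> nat -> nat) : small I S ->
  exists h : nat -> nat, forall s, exists n0, forall n, n0 <= n -> g s n <= h n.
Proof.
move=> /small_enum[W [e [ei Ws]]].
have /choice[f hf] : forall d, exists f : nat -> nat, forall n s,
    W d s -> e d s <= n -> g s n <= f n.
  move=> d; have /choice[f hf] : forall n, exists b, forall s,
      W d s -> e d s <= n -> g s n <= b.
    by move=> n; apply: bounded_below_code => s t; exact: ei.
  by exists f.
have [Z uZ bZ] := precaliber_bounded f.
have [h hh] := choice bZ; exists h => s.
have [d Zd /contrapT Wd] := uncountable_avoid uZ (Ws s).
exists (e d s) => n en; apply: leq_trans (hh n d Zd); exact: hf.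
Qed.

End PrecaliberConsequences.

(** * Pseudo-intersections *)

Section PseudoIntersection.
Variable I : choiceType.
Hypothesis PC : precaliber_families I.
Hypothesis smallI : small I I.
Variable r : I -> nat -> bool.
Hypothesis r_inj : injective r.

Section Slalom.
Variables (i : nat -> nat) (A : I -> nat -> set nat).
Hypothesis A_lt : forall d n k, A d n k -> k < i n.+1.
Hypothesis A_fip : forall a : seq I, exists m, forall n, m <= n ->
  exists k, forall d, d \in a -> A d n k.

(** Level [n] is constrained only if two members of the condition first differ there. Singletons are
    thus conditions for free, whereas an uncountable set of indices splits at arbitrarily high
    levels. *)
Let K (a : seq I) := forall d e n, d \in a -> e \in a ->
  r d n <> r e n -> (forall j, j < n -> r d j = r e j) ->
  exists x y, [/\ x < i n.+1, y < i n.+1 &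
    forall c, c \in a -> A c n x \/ A c n y].

(* Beyond the level [m a] where the sets [A d n], [d] in [a], have a common
   point, two points always suffice for the union of two conditions. *)
Lemma two_point_family : pccc_family K.
Proof.
have [m hm] := choice A_fip.
(* Below level [k] finitely much has to be remembered of an index: its bits and, as [A_lt] bounds
   the sets, their traces below [i n.+1]. *)
pose cd k (d : I) := ([seq r d j | j <- iota 0 k],
  [seq [seq `[< A d n x >] | x <- iota 0 (i n.+1)] | n <- iota 0 k]).
have cdE k d d' : cd k d = cd k d' -> (forall j, j < k -> r d j = r d' j) /\
    (forall n x, n < k -> x < i n.+1 -> A d n x -> A d' n x).
  move=> [/eq_in_map e1 /eq_in_map e2]; split=> [j jk|n x nk xi].
    by apply: e1; rewrite mem_iota.
  have /eq_in_map e3 := e2 n ltac:(by rewrite mem_iota).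
  have e4 := e3 x ltac:(by rewrite mem_iota).
  by move=> /asboolP; rewrite e4 => /asboolP.
pose tau (a : seq I) := (m a, [seq cd (m a) d | d <- a]).
apply: (typed_pccc_family (tau := tau)) => a b Ka Kb [mab].
rewrite -mab => e.
(* Every member of the union has a twin in [a] with the same code, so below [m a] the two points
   provided by [Ka] serve the union. *)
have rep c : c \in a ++ b -> exists2 c', c' \in a & cd (m a) c' = cd (m a) c.
  rewrite mem_cat => /orP[ca|cb]; first by exists c.
  have /mapP[c' ca ->] : cd (m a) c \in [seq cd (m a) d | d <- a].
    by rewrite e; apply: map_f.
  by exists c'.
move=> d d' n dab d'ab rn rj.
have [nm|mn] := ltnP n (m a).
  have [c ca /cdE[ec _]] := rep d dab; have [c' ca' /cdE[ec' _]] := rep d' d'ab.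
  have [|j jn|x [y [xi yi xy]]] := Ka c c' n ca ca'; rewrite ?ec ?ec' //.
  - exact: rj.
  - exact: ltn_trans jn nm.
  - exact: ltn_trans jn nm.
  exists x, y; split=> // f /rep[f' /xy fa /cdE[_ ef]].
  by case: fa => h; [left|right]; exact: ef h.
have [x hx] := hm a n mn; have [y hy] : exists k, forall d, d \in b -> A d n k.
  by apply: hm; rewrite -mab.
(* A point can reach the bound only if its side of the union is empty, since otherwise [A_lt]
   applies; the last three cases dispose of an empty side. *)
have [xi|] := ltnP x (i n.+1); have [yi|] := ltnP y (i n.+1).
- exists x, y; split=> // c; rewrite mem_cat => /orP[/hx|/hy]; by [left|right].
- move=> iy; exists x, x; split=> // c; rewrite mem_cat => /orP[/hx|/hy/A_lt]; [by left|].
  by rewrite ltnNge iy.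
- move=> ix; exists y, y; split=> // c; rewrite mem_cat => /orP[/hx/A_lt|/hy]; [|by left].
  by rewrite ltnNge ix.
- move=> iy ix; exists 0, 0; split; rewrite ?(leq_ltn_trans _ (A_lt _)) //.
  + move: dab; rewrite mem_cat => /orP[/hx/A_lt|/hy/A_lt].
      by rewrite ltnNge ix.
    by rewrite ltnNge iy.
  + move: dab; rewrite mem_cat => /orP[/hx/A_lt|/hy/A_lt].
      by rewrite ltnNge ix.
    by rewrite ltnNge iy.
  + move=> c; rewrite mem_cat => /orP[/hx/A_lt|/hy/A_lt].
      by rewrite ltnNge ix.
    by rewrite ltnNge iy.
Qed.

Lemma two_point_slalom : exists (Z : set I) (N : set nat) (X Y : nat -> nat),
  [/\ ~ countable Z, forall k, exists2 n, N n & k <= n,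
      forall n, X n < i n.+1 /\ Y n < i n.+1 \/ ~ N n &
      forall n d, N n -> Z d -> A d n (X n) \/ A d n (Y n)].
Proof.
have [a b ab Kb|d|Z uZ hZ] := PC _ _ two_point_family.
- move=> d e n da ea rn rj.
  have [x [y [xi yi h]]] := Kb d e n (ab _ da) (ab _ ea) rn rj.
  by exists x, y; split=> // c ca; apply: h; exact: ab.
- by move=> e f n; rewrite !inE => /eqP-> /eqP->.
pose N n := exists d e, [/\ Z d, Z e, r d n <> r e n & forall j, j < n -> r d j = r e j].
have /choice[XY hXY] n : exists xy : nat * nat, N n ->
    [/\ xy.1 < i n.+1, xy.2 < i n.+1 &
        forall d, Z d -> A d n xy.1 \/ A d n xy.2].
  have [[d [e [Zd Ze rn rj]]]|nN] := pselect (N n); last by exists (0, 0).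
  apply: contrapT => h.
  (* Only finitely many pairs lie below [i n.+1]. If each failed for some index of [Z], these
     indices and the splitting pair [d], [e] would form a finite subset of [Z] outside [K]. *)
  have /choice[c hc] (xy : nat * nat) : exists c, Z c /\
      (xy.1 < i n.+1 -> xy.2 < i n.+1 -> ~ (A c n xy.1 \/ A c n xy.2)).
    apply: contrapT => h'; apply: h; exists xy => _; split.
    - rewrite ltnNge; apply/negP => le; apply: h'; exists d; split=> //.
      by rewrite ltnNge le.
    - rewrite ltnNge; apply/negP => le; apply: h'; exists d; split=> // _.
      by rewrite ltnNge le.
    - move=> f Zf; apply: contrapT => nf; apply: h'; exists f; split=> //.
  pose a := d :: e :: [seq c (x, y) | x <- iota 0 (i n.+1), y <- iota 0 (i n.+1)].
  have [f|||//|//|x [y [xi yi xy]]] := hZ a _ d e n.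
  - rewrite !inE => /orP[/eqP->//|/orP[/eqP->//|/allpairsP[p [_ _ ->]]]].
    by have [] := hc (p.1, p.2).
  - by rewrite inE eqxx.
  - by rewrite !inE eqxx orbT.
  have [_ h'] := hc (x, y); apply: h' => //; apply: xy.
  rewrite !inE; apply/orP; right; apply/orP; right; apply/allpairsP.
  by exists (x, y); rewrite !mem_iota.
exists Z, N, (fun n => (XY n).1), (fun n => (XY n).2); split=> //.
(* Countably many bit strings of length [k]: two members of [Z] agree below [k], and by injectivity
   of [r] they split later. *)
- move=> k; have [u uu] := uncountable_type (fun d => [seq r d j | j <- iota 0 k]) uZ.
  have [d [e [[Zd du] [Ze eu] de]]] := uncountable_two uu.
  have agree j : j < k -> r d j = r e j.
    move=> jk; have := du; rewrite -eu => /eq_in_map; apply.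
    by rewrite mem_iota.
  have : exists n, r d n != r e n.
    apply: contrapT => h; apply: de; apply: r_inj; apply: funext => n.
    by apply/eqP; apply: contrapT => /negP ?; apply: h; exists n.
  move=> /ex_minnP[n /eqP rn nmin]; exists n.
    exists d, e; split=> // j jn; apply/eqP; apply: contraTT jn => /nmin.
    by rewrite -leqNgt.
  by rewrite leqNgt; apply/negP => /agree.
- move=> n; have [Nn|] := pselect (N n); last by right.
  by left; have [] := hXY n Nn.
- by move=> n d Nn Zd; have [_ _] := hXY n Nn; apply.
Qed.

End Slalom.

Lemma precaliber_pseudo_intersection (S : Type) (F : S -> set nat) :
  small I S ->
  (forall (l : seq S) k, exists2 n, k <= n & forall s, List.In s l -> F s n) ->
  exists2 B : set nat, (forall k, exists2 n, B n & k <= n) &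
    forall s, exists n0, forall n, n0 <= n -> B n -> F s n.
Proof.
move=> /small_enum[W [e [ei Ws]]] fip.
have below (a : seq I) n : exists l : seq S, forall d s, d \in a ->
    W d s -> e d s <= n -> List.In s l.
  elim: a => [|d a [l hl]]; first by exists [::].
  have [l' hl'] := finite_below_code n (ei d).
  exists (l' ++ l)%list => d' s; rewrite inE => /orP[/eqP->|da] Wd ed.
    by apply/List.in_or_app; left; exact: hl'.
  by apply/List.in_or_app; right; exact: hl da Wd ed.
have /choice[g hg] : forall a : seq I, exists g : nat -> nat, forall n, n < g n /\
    forall d s, d \in a -> W d s -> e d s <= n -> F s (g n).
  move=> a; have /choice[g hg] : forall n, exists k, n < k /\
      forall d s, d \in a -> W d s -> e d s <= n -> F s k.
    move=> n; have [l hl] := below a n; have [k nk hk] := fip l n.+1.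
    by exists k; split=> // d s da Wd ed; apply: hk; exact: hl da Wd ed.
  by exists g.
(* [h] dominates the choice functions of all finite sets of indices at once, and [i] jumps past [h];
   hence [g a (i n)] falls into the [n]-th interval for almost all [n]. *)
have [h hh] := precaliber_dominating PC g (small_seq smallI).
pose i n := iter n (fun k => (maxn (h k) k).+1) 0.
have i_lt n : i n < i n.+1 by rewrite ltnS /= leq_maxr.
have i_mono n k : n <= k -> i n <= i k.
  by elim: k => [|k IH]; [rewrite leqn0 => /eqP->|
    rewrite leq_eqVlt ltnS => /orP[/eqP->//|/IH/leq_trans]; apply; exact: ltnW].
have i_ge n : n <= i n by elim: n => // n IH; exact: leq_ltn_trans IH (i_lt n).
pose A d n k := [/\ i n <= k, k < i n.+1 & forall s, W d s -> e d s <= n -> F s k].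
have [|a|Z [N [X [Y [uZ Ninf XYlt XYA]]]]] := @two_point_slalom i A.
- by move=> d n k [].
- have [n0 hn0] := hh a; exists n0 => n n0n; exists (g a (i n)) => d da.
  have [lt gF] := hg a (i n).
  have le := hn0 (i n) (leq_trans n0n (i_ge n)).
  split; first exact: ltnW.
    by rewrite ltnS (leq_trans le) // leq_maxl.
  by move=> s Wd ed; apply: gF da Wd _; exact: leq_trans ed (i_ge n).
have pair s t : exists n0, forall n, n0 <= n -> N n ->
    exists k, [/\ k = X n \/ k = Y n, i n <= k, F s k & F t k].
  have [d Zd /not_orP[/contrapT Wds /contrapT Wdt]] :=
    uncountable_avoid uZ (countable_setU (Ws s) (Ws t)).
  exists (maxn (e d s) (e d t)) => n; rewrite geq_max => /andP[sn tn] Nn.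
  by case: (XYA n d Nn Zd) => -[ik _ kF];
    [exists (X n)|exists (Y n)]; split=> //; auto.
have late n n0 v : N n -> v = X n \/ v = Y n -> i n0 <= v -> n0 <= n.
  move=> Nn vXY iv; rewrite leqNgt; apply/negP => /i_mono le.
  have [[Xl Yl]|//] := XYlt n.
  have : v < i n.+1 by case: vXY => ->.
  by rewrite ltnNge (leq_trans le iv).
(* If some [s] rejects a candidate at infinitely many levels, keep there the candidate in [F s]: by
   [pair] it also lies in any other [F t] from some level on. If there is no such [s], both
   candidates can be kept. *)
have [[s hs]|hs] := pselect (exists s, forall k, exists2 n, k <= n &
    N n /\ ~ (F s (X n) /\ F s (Y n))).
- exists [set v | exists n, [/\ N n, ~ (F s (X n) /\ F s (Y n)), F s v,
      v = X n \/ v = Y n & i n <= v]].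
    move=> k; have [n0 hn0] := pair s s.
    have [n kn [Nn nF]] := hs (maxn n0 k).
    move: kn; rewrite geq_max => /andP[n0n kn].
    have [v [vXY iv sv _]] := hn0 n n0n Nn.
    by exists v; [exists n|exact: leq_trans (leq_trans kn (i_ge n)) iv].
  move=> t; have [n0 hn0] := pair s t; exists (i n0) => v iv [n [Nn nF sv vXY _]].
  have [k [kXY _ sk tk]] := hn0 n (late _ _ _ Nn vXY iv) Nn.
  suff -> : v = k by [].
  by case: vXY kXY => [ev|ev] [ek|ek]; rewrite ev ek // in sv sk *; case: nF.
- exists [set v | exists n, [/\ N n, v = X n \/ v = Y n & i n <= v]].
    move=> k; have [n Nn kn] := Ninf k.
    have [d Zd _] := uncountable_avoid uZ (countable0 _).
    have le := leq_trans kn (i_ge n).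
    by case: (XYA n d Nn Zd) => -[ik _ _]; [exists (X n)|exists (Y n)];
      rewrite ?(leq_trans le) //; exists n; split=> //; auto.
  move=> s; have [k hk] : exists k, forall n, k <= n -> N n -> F s (X n) /\ F s (Y n).
    apply: contrapT => nk; apply: hs; exists s => k; apply: contrapT => h'.
    apply: nk; exists k => n kn Nn; apply: contrapT => nF; apply: h'.
    by exists n.
  exists (i k) => v iv [n [Nn vXY _]].
  have [? ?] := hk n (late _ _ _ Nn vXY iv) Nn.
  by case: vXY => ->.
Qed.

End PseudoIntersection.

(** * Sigma-centeredness *)

Lemma ultrafilter_color (T : Type) (U : set_system T) (UU : UltraFilter U)
    (chi : T -> nat) (n : nat) :
  U [set l | chi l <= n] -> exists2 j, j <= n & U [set l | chi l = j].
Proof.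
elim: n => [|n IH] Un.
  by exists 0 => //; apply: filterS Un => l /=; rewrite leqn0 => /eqP.
have [h|h] := in_ultra_setVsetC [set l | chi l = n.+1] UU; first by exists n.+1.
have [|j jn Uj] := IH; last by exists j => //; exact: leqW.
apply: filterS (filterI Un h) => l /= [le ne].
by move: le; rewrite leq_eqVlt ltnS => /orP[/eqP/ne|].
Qed.

(** The bounds [q] depend on the finite set [l]; what survives in the limit is which of the [n.+1]
    bounds serves [s]. The limit is taken along an ultrafilter containing all cones of finite sets,
    so finitely many elements of one limit colour share an [l] that realises it. *)
Lemma finite_coloring_compactness (S : Type) (A : set S) (n : nat)
    (le : S -> S -> Prop) :
  (forall l : seq S, (forall s, List.In s l -> A s) -> exists q : nat -> S,
     forall s, List.In s l -> exists2 j, j <= n & le (q j) s) ->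
  exists c : S -> nat, forall (l : seq S) j,
    (forall s, List.In s l -> A s /\ c s = j) ->
    exists q, forall s, List.In s l -> le q s.
Proof.
move=> fin.
pose B := [set l : seq S | forall s, List.In s l -> A s].
have /choice[q hq] (l : seq S) : exists q : nat -> S, B l ->
    forall s, List.In s l -> exists2 j, j <= n & le (q j) s.
  have [Bl|nB] := pselect (B l); first by have [q hq] := fin l Bl; exists q.
  by have [//|x _] := fin [::]; exists x.
have /choice[chi hchi] (ls : seq S * S) : exists j, B ls.1 -> List.In ls.2 ls.1 ->
    j <= n /\ le (q ls.1 j) ls.2.
  have [Bl|nB] := pselect (B ls.1); last by exists 0.
  have [sl|nsl] := pselect (List.In ls.2 ls.1); last by exists 0.
  by have [j jn lj] := hq _ Bl _ sl; exists j.
pose above l0 := [set l | B l /\ forall s, List.In s l0 -> List.In s l].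
pose F := [set P : set (seq S) | exists2 l0, B l0 & above l0 `<=` P].
have FF : ProperFilter F.
  split.
  - by move=> [l0 Bl0 /(_ l0)]; apply.
  - split.
    + by exists [::] => // s [].
    + move=> P Q [l Bl hl] [m Bm hm]; exists (l ++ m)%list.
        by move=> s sk; have [/Bl|/Bm] := List.in_app_or _ _ _ sk.
      move=> k [Bk hk]; split; [apply: hl|apply: hm]; split=> // s sl; apply: hk;
        apply/List.in_or_app; by [left|right].
    + by move=> P Q PQ [l Bl hl]; exists l => //; exact: subset_trans hl PQ.
have [U [UU FU]] := ultraFilterLemma FF.
have Uabove l : B l -> U (above l) by move=> Bl; apply: FU; exists l.
have /choice[c hc] (s : S) : exists j, A s -> U [set l | chi (l, s) = j].
  have [As|nA] := pselect (A s); last by exists 0.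
  have [|j jn Uj] := @ultrafilter_color _ U UU (fun l => chi (l, s)) n.
    have Bs : B [:: s] by move=> t [<-|[]].
    apply: filterS (Uabove _ Bs) => l /= [Bl sl].
    by have [] := hchi (l, s) Bl (sl s (or_introl erefl)).
  by exists j.
exists c => l j hl.
have Bl : B l by move=> s /hl[].
have Ul : forall m : seq S, (forall s, List.In s m -> List.In s l) ->
    U [set k | forall s, List.In s m -> chi (k, s) = j].
  elim=> [|s m IH] ml; first by apply: filterS filterT => k _ s [].
  have [As cs] := hl s (ml s (or_introl erefl)).
  have IH' := IH (fun t tm => ml t (or_intror tm)).
  apply: filterS (filterI (hc s As) IH') => k /= [ks km] t [<-|/km//].
  by rewrite ks.
have [k [[Bk lk] kj]] := filter_ex (filterI (Uabove l Bl) (Ul l (fun s h => h))).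
exists (q k j) => s sl; have [_] := hchi (k, s) Bk (lk s sl).
by rewrite /= kj.
Qed.

Section CccFamilies.
Variables (S : Type) (le : S -> S -> Prop).
Hypothesis le_refl : forall s, le s s.
Hypothesis pccc : powerfully_ccc le.

Lemma powerfully_ccc_finType (T : Type) (J : finType) (f : T -> J -> S) (G : set T) :
  ~ countable G -> exists x y, [/\ G x, G y, x <> y &
    exists z : J -> S, forall j, le (z j) (f x j) /\ le (z j) (f y j)].
Proof.
move=> uG; pose F x (k : 'I_#|J|) := f x (enum_val k).
have [cF|uF] := pselect (countable (F @` G)).
  have [x Gx|p _ up] := uncountable_fiber (f := F) uG cF; first by exists x.
  have [x [y [[Gx Fx] [Gy Fy] xy]]] := uncountable_two up.
  exists x, y; split=> //; exists (f x) => j; split=> //.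
  have /(congr1 (fun g => g (enum_rank j))) : F y = F x by rewrite Fx Fy.
  by rewrite /F enum_rankK => ->.
have : ~ antichain (power_le le (n := #|J|)) (F @` G) by move=> /pccc.
apply: contra_notP => h p q [x Gx <-] [y Gy <-] Fxy [z [zx zy]]; apply: h.
exists x, y; split=> //; first by move=> exy; apply: Fxy; rewrite exy.
exists (fun j => z (enum_rank j)) => j.
by have := conj (zx (enum_rank j)) (zy (enum_rank j)); rewrite /F enum_rankK.
Qed.

End CccFamilies.

Section SigmaCentered.
Variable I : choiceType.
Hypothesis PC : precaliber_families I.
Variables (S : Type) (le : S -> S -> Prop).
Hypothesis le_refl : forall s, le s s.
Hypothesis le_trans : forall s t u, le s t -> le t u -> le s u.
Hypothesis pccc : powerfully_ccc le.

Let K (W : I -> set S) (e : I -> S -> nat) (a : seq I) := forall n, exists q : nat -> S,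
  forall d s, d \in a -> W d s -> e d s = n -> exists2 j, j <= n & le (q j) s.

(* The codes [e d] being injective, [size a] bounded pieces suffice at every
   level [n], so only the levels below twice the size of a condition matter. *)
Lemma centered_pieces_family W e (s0 : S) :
  (forall d s t, W d s -> W d t -> e d s = e d t -> s = t) -> pccc_family (K W e).
Proof.
move=> ei N G uG GK.
have [t ut] := uncountable_type (fun f : 'I_N -> seq I => [ffun j => size (f j)]) uG.
pose m := (\max_j t j).*2.
have /choice[q hq] f : exists q : 'I_N -> nat -> nat -> S, G f -> forall k n d s,
    d \in f k -> W d s -> e d s = n -> exists2 j, j <= n & le (q k n j) s.
  have [Gf|nG] := pselect (G f); last by exists (fun _ _ _ => s0).
  have /choice[q hq] k : exists q : nat -> nat -> S, forall n d s,
      d \in f k -> W d s -> e d s = n -> exists2 j, j <= n & le (q n j) s.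
    by have /choice[q hq] := GK f Gf k; exists q.
  by exists q.
(* The lower bounds in all [N] coordinates at all levels up to [m] form one finite tuple. A single
   use of the ccc of a power of [le] gives [z], whose entries bound the corresponding pieces of both
   conditions. *)
have [f [g [[Gf tf] [Gg tg] fg [z hz]]]] := powerfully_ccc_finType le_refl pccc
  (fun f (knj : 'I_N * 'I_m.+1 * 'I_m.+1) => q f knj.1.1 knj.1.2 knj.2) ut.
exists f, g; split=> // k n.
have sf : size (f k) = t k by rewrite -tf ffunE.
have sg : size (g k) = t k by rewrite -tg ffunE.
have tm : (t k).*2 <= m.
  by rewrite leq_double; apply: (leq_bigmax_cond (F := fun j => t j)).
have [nm|mn] := ltnP n m.+1.
- exists (fun j => z (k, Ordinal nm, inord j)) => d s dfg Wd ed.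
  have inm j : j <= n -> (inord j : 'I_m.+1) = j :> nat.
    by move=> jn; rewrite inordK //; exact: leq_ltn_trans jn nm.
  move: dfg; rewrite mem_cat => /orP[df|dg].
    have [j jn qj] := hq f Gf k n d s df Wd ed; exists j => //.
    have [zf _] := hz (k, Ordinal nm, inord j); apply: le_trans zf _.
    by rewrite /= inm.
  have [j jn qj] := hq g Gg k n d s dg Wd ed; exists j => //.
  have [_ zg] := hz (k, Ordinal nm, inord j); apply: le_trans zg _.
  by rewrite /= inm.
- have /choice[q' hq'] d : exists s, forall s', W d s' -> e d s' = n -> s' = s.
    have [[s [Ws es]]|h] := pselect (exists s, W d s /\ e d s = n).
      by exists s => s' Ws' es'; apply: (ei d); rewrite ?es.
    by exists s0 => s' Ws' es'; case: h; exists s'.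
  have : size (f k ++ g k) <= n.+1.
    by rewrite size_cat sf sg addnn (leq_trans tm) //; lia.
  case: (f k ++ g k) => [|d0 a] sa; first by exists (fun=> s0).
  exists (fun j => q' (nth d0 (d0 :: a) j)) => d s da Wd ed.
  exists (index d (d0 :: a)).
    by rewrite -ltnS; apply: leq_trans sa; rewrite index_mem.
  by rewrite nth_index // (hq' d s).
Qed.

(** An uncountable homogeneous [Z] sees every [s] under some code [n]. The elements seen under code
    [n] are covered, finite set by finite set, by [n.+1] bounded pieces; compactness makes this a
    colouring with centered classes, and the final colour is the pair of [n] and that colour. *)
Lemma precaliber_sigma_centered (s0 : S) : small I S -> exists c : S -> nat,
  forall (l : seq S) n, (forall s, List.In s l -> c s = n) ->
  exists q, forall s, List.In s l -> le q s.
Proof.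
move=> /small_enum[W [e [ei Ws]]].
have [a b ab Kb n|d n|Z uZ hZ] := PC _ _ (centered_pieces_family s0 ei).
- by have [q hq] := Kb n; exists q => d s da; apply: hq; exact: ab.
- have [[s [Wd es]]|h] := pselect (exists s, W d s /\ e d s = n).
    exists (fun=> s) => d' s'; rewrite inE => /eqP-> Wd' es'; exists 0 => //.
    by rewrite (ei d s' s) ?es.
  exists (fun=> s0) => d' s'; rewrite inE => /eqP-> Wd' es'; case: h.
  by exists s'.
have /choice[c hc] n : exists c : S -> nat, forall (l : seq S) j,
    (forall s, List.In s l -> (exists d, [/\ Z d, W d s & e d s = n]) /\ c s = j) ->
    exists q, forall s, List.In s l -> le q s.
  apply: (@finite_coloring_compactness _ [set s | exists d, [/\ Z d, W d s & e d s = n]] n).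
  move=> l lA.
  have [a [aZ al]] : exists a : seq I, (forall i, i \in a -> Z i) /\
      forall s, List.In s l -> exists d, [/\ d \in a, W d s & e d s = n].
    elim: l lA => [|s l IH] lA; first by exists [::].
    have [a [aZ al]] := IH (fun t tl => lA t (or_intror tl)).
    have [d [Zd Wd ed]] := lA s (or_introl erefl).
    exists (d :: a); split=> [i|t [<-|/al[d' [da Wd' ed']]]].
    - by rewrite inE => /orP[/eqP->|/aZ].
    - by exists d; rewrite inE eqxx.
    - by exists d'; rewrite inE da orbT.
  have [q hq] := hZ a aZ n; exists q => s /al[d [da Wd ed]].
  exact: hq da Wd ed.
have /choice[n hn] s : exists n, exists d, [/\ Z d, W d s & e d s = n].
  have [d Zd /contrapT Wd] := uncountable_avoid uZ (Ws s).
  by exists (e d s), d.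
exists (fun s => pickle (n s, c (n s) s)) => l k hl.
case: l hl => [|s l] hl; first by exists s0.
have key t : List.In t (s :: l) -> n t = n s /\ c (n s) t = c (n s) s.
  move=> tl; have /(pcan_inj pickleK)[<- ->] :
    pickle (n t, c (n t) t) = pickle (n s, c (n s) s) by rewrite !hl //; left.
  by [].
apply: (hc (n s) _ (c (n s) s)) => t /key[nt ct]; split=> //.
by rewrite -nt.
Qed.

End SigmaCentered.

(** * Generic filters *)

Section SmallPosets.
Variable I : choiceType.
Hypothesis PC : precaliber_families I.
Hypothesis smallI : small I I.
Variable r : I -> nat -> bool.
Hypothesis r_inj : injective r.

(* Bell's argument: the centered pieces [C m] play the role of ultrafilters, and
   the generic filter is the limit of a sequence of pieces. *)
Lemma precaliber_linked_generic (S T : Type) (le : S -> S -> Prop) (s0 : S)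
    (E : T -> set S) :
  (forall s, le s s) -> (forall s t u, le s t -> le t u -> le s u) ->
  powerfully_ccc le -> small I S -> small I T ->
  (forall t, dense_in le (E t)) -> (forall t p q, E t p -> le q p -> E t q) ->
  exists G : set S, [/\ forall s t, G s -> le s t -> G t,
    forall t, G `&` E t !=set0 & forall s t, G s -> G t -> compatible le s t].
Proof.
move=> le_refl le_trans pccc smallS smallT Edense Eopen.
have [c hc] := precaliber_sigma_centered PC le_refl le_trans pccc s0 smallS.
(* The piece is numbered by the 2-adic valuation of [m], which takes each value at arbitrarily large
   [m]; thus every piece recurs infinitely often. *)
pose C m s := exists2 s', c s' = logn 2 m & le s' s.
have CW m s t : C m s -> le s t -> C m t.
  by move=> [s' cs' s's] st; exists s' => //; exact: le_trans s's st.
have Clinked m s t : C m s -> C m t -> compatible le s t.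
  move=> [s' cs' s's] [t' ct' t't].
  have [|q hq] := hc [:: s'; t'] (logn 2 m); first by move=> x [<-|[<-|[]]].
  exists q; split; [apply: le_trans s's|apply: le_trans t't]; apply: hq => /=; auto.
(* [inl s] asks the next piece to keep [s], [inr t] asks it to meet [E t]. A pseudo-intersection of
   these sets is the set [B n] of admissible successors of [n]. *)
pose F n (x : S + T) : set nat := match x with
  | inl s => [set m | C n s -> C m s]
  | inr t => [set m | exists2 q, E t q & C m q] end.
have fip n (l : seq (S + T)) k :
    exists2 m, k <= m & forall x, List.In x l -> F n x m.
  have [l' [l'c l'l]] : exists l' : seq S, (forall s, List.In s l' -> c s = logn 2 n) /\
      forall s, List.In (inl s) l -> C n s -> exists2 s', List.In s' l' & le s' s.
    elim: l => [|[s|t] l [l' [l'c l'l]]]; first by exists [::].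
      have [[s' cs' s's]|nC] := pselect (C n s).
        exists (s' :: l'); split=> [x [<-//|/l'c//]|x [[<-] _|/l'l h /h[y yl yx]]].
          by exists s' => //; left.
        by exists y => //; right.
      by exists l'; split=> // x [[<-]|/l'l].
    by exists l'; split=> // x [//|/l'l].
  (* Finitely many requirements reduce to one condition: elements of the centered piece below the
     [s] to be kept have a lower bound [r0], which is then pushed into finitely many open dense
     sets. The piece of the result recurs beyond [k]. *)
  have [r0 hr0] := hc l' _ l'c.
  have [q [qr0 qE]] : exists q, le q r0 /\ forall t, List.In (inr t) l -> E t q.
    elim: l {l'l} => [|[s|t] l [q [qr qE]]]; first by exists r0.
      by exists q; split=> // t [//|/qE].
    have [q' Eq' q'q] := Edense t q; exists q'; split; first exact: le_trans q'q qr.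
    by move=> t' [[<-]//|/qE Eq]; exact: Eopen Eq q'q.
  exists (2 ^ c q * k.*2.+1).
    have : 0 < 2 ^ c q by rewrite expn_gt0.
    nia.
  have lg : logn 2 (2 ^ c q * k.*2.+1) = c q.
    rewrite lognM ?expn_gt0 // pfactorK // logn_coprime ?addn0 //.
    by rewrite coprime2n /= odd_double.
  have Cq : C (2 ^ c q * k.*2.+1) q by exists q.
  move=> [s|t] xl /=; last by exists q => //; exact: qE.
  move=> Cs; have [s' /hr0 rs' s's] := l'l s xl Cs.
  exact: CW Cq (le_trans _ _ _ qr0 (le_trans _ _ _ rs' s's)).
have /choice[B hB] n : exists B : set nat,
    (forall k, exists2 m, B m & k <= m) /\
    forall x, exists n0, forall m, n0 <= m -> B m -> F n x m.
  have [B Binf BF] := precaliber_pseudo_intersection PC smallI r_inj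
    (small_sum smallS smallT) (fip n).
  by exists B.
have /choice[thr hthr] (nx : nat * (S + T)) : exists n0, forall m,
    n0 <= m -> B nx.1 m -> F nx.1 nx.2 m by have [_] := hB nx.1; apply.
have /choice[q hq] (tn : T * nat) : exists q,
    (exists2 q, E tn.1 q & C tn.2 q) -> E tn.1 q /\ C tn.2 q.
  have [[q Eq Cq]|nq] := pselect (exists2 q, E tn.1 q & C tn.2 q); first by exists q.
  by exists s0.
(* Beyond [g t n], an element of [B n] keeps all witnesses [q (t, j)] with [j <= n], and meets
   [E t]. The witness chosen at [p n0.+1] has index at most every later [p j], so it is never
   dropped. *)
pose g t n := maxn (thr (n, inr t)) (\max_(j < n.+1) thr (n, inl (q (t, val j)))).
have [h hh] := precaliber_dominating PC g smallT.
have /choice[nx hnx] n : exists m, B n m /\ maxn (h n) n.+1 <= m.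
  by have [/(_ (maxn (h n) n.+1))[m Bm le_m] _] := hB n; exists m.
pose p i := iter i nx 0.
have p_lt i : p i < p i.+1.
  by have [_] := hnx (p i); rewrite geq_max => /andP[].
have p_h i : h (p i) <= p i.+1.
  by have [_] := hnx (p i); rewrite geq_max => /andP[].
have p_ge i : i <= p i by elim: i => // i IH; exact: leq_ltn_trans IH (p_lt i).
have p_mono i j : i <= j -> p i <= p j.
  elim: j => [|j IH]; first by rewrite leqn0 => /eqP->.
  rewrite leq_eqVlt ltnS => /orP[/eqP->//|/IH/leq_trans]; apply.
  exact: ltnW.
exists [set s | exists j0, forall j, j0 <= j -> C (p j) s]; split.
- by move=> s t [j0 hs] st; exists j0 => j /hs Cs; exact: CW Cs st.
- move=> t; have [n0 hn0] := hh t.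
  have gp j : n0 <= j -> g t (p j) <= p j.+1.
    move=> n0j; apply: leq_trans (p_h j); apply: hn0.
    exact: leq_trans n0j (p_ge j).
  have [] := hq (t, p n0.+1).
    have := gp n0 (leqnn _); rewrite geq_max => /andP[le1 _].
    by have := hthr (p n0, inr t) (p n0.+1) le1 (hnx _).1.
  set s := q _ => /= Es Cs; exists s; split=> //=; exists n0.+1 => j.
  elim: j => // j IH; rewrite leq_eqVlt => /orP[/eqP<-//|]; rewrite ltnS => n0j.
  apply: (hthr (p j, inl s) (p j.+1)) (hnx _).1 (IH n0j).
  apply: leq_trans (gp j (ltnW n0j)); rewrite leq_max; apply/orP; right.
  have lt : p n0.+1 < (p j).+1 by rewrite ltnS p_mono.
  exact: (leq_bigmax (F := fun k : 'I_(p j).+1 => thr (p j, inl (q (t, val k))))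
    (Ordinal lt)).
- move=> s t [j0 hs] [j1 ht]; apply: (Clinked (p (maxn j0 j1))).
    by apply: hs; rewrite leq_maxl.
  by apply: ht; rewrite leq_maxr.
Qed.

(** A linked set becomes a filter once compatibility is decided inside it: [E' (inr (s, t))]
    contains the common lower bounds of [s] and [t] and the conditions incompatible with one of
    them, and linkedness excludes the latter. [E' (inl t)] is the downward closure that openness
    requires. *)
Lemma precaliber_generic_small (S T : Type) (le : S -> S -> Prop) (s0 : S)
    (E : T -> set S) :
  (forall s, le s s) -> (forall s t u, le s t -> le t u -> le s u) ->
  powerfully_ccc le -> small I S -> small I T -> (forall t, dense_in le (E t)) ->
  exists G : set S, poset_filter le G /\ forall t, G `&` E t !=set0.
Proof.
move=> le_refl le_trans pccc smallS smallT Edense.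
pose E' (x : T + S * S) : set S := match x with
  | inl t => [set q | exists2 p, E t p & le q p]
  | inr (s, t) => [set q | le q s /\ le q t \/
      ~ (compatible le q s /\ compatible le q t)] end.
have [||G [Gup GE Glinked]] := @precaliber_linked_generic S (T + S * S) le s0 E'
  le_refl le_trans pccc smallS (small_sum smallT (small_prod smallS smallS)).
- move=> [t|[s t]] p /=.
    by have [q Eq qp] := Edense t p; exists q => //; exists q.
  have [[r1 [r1p r1s]]|ns] := pselect (compatible le p s); last first.
    by exists p => //; right => -[].
  have [[r2 [r21 r2t]]|nt] := pselect (compatible le r1 t).
    exists r2; first by left; split=> //; exact: le_trans r21 r1s.
    exact: le_trans r21 r1p.
  by exists r1 => //; right => -[].
- move=> [t|[s t]] p q /=; first by move=> [p' Ep' pp'] qp; exists p' => //; exact: le_trans qp pp'.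
  move=> [[ps pt]|np] qp; first by left; split; apply: le_trans qp _.
  right => -[[u [uq us]] [v [vq vt]]]; apply: np; split.
    by exists u; split=> //; exact: le_trans uq qp.
  by exists v; split=> //; exact: le_trans vq qp.
exists G; split; last first.
  move=> t; have [q [Gq [p Ep qp]]] := GE (inl t).
  by exists p; split=> //; exact: Gup Gq qp.
split; first by have [q [Gq _]] := GE (inr (s0, s0)); exists q.
split=> // s t Gs Gt; have [q [Gq [[qs qt]|nq]]] := GE (inr (s, t)).
  by exists q.
by case: nq; split; apply: Glinked.
Qed.

(** Names for the closure of one condition under a chosen refinement into each [D i] and a chosen
    lower bound of compatible pairs. Names are only preordered, which is why the preceding lemmas
    are stated for preorders. *)
Inductive term := Base | Ext of I & term | Meet of term & term.

Fixpoint term_code (e : I -> nat) t : seq nat := match t with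
  | Base => [:: 0]
  | Ext i t => [:: 1, e i & term_code e t]
  | Meet t u => 2 :: (term_code e t ++ term_code e u) end.

Fixpoint term_labels (A : set I) t : Prop := match t with
  | Base => True
  | Ext i t => A i /\ term_labels A t
  | Meet t u => term_labels A t /\ term_labels A u end.

(** Codes are in prefix form; the arbitrary tails [x], [y] carry the induction through the
    concatenation in [Meet]. *)
Lemma term_code_inj (A : set I) (e : I -> nat) :
  (forall i j, A i -> A j -> e i = e j -> i = j) ->
  forall t u x y, term_labels A t -> term_labels A u ->
  term_code e t ++ x = term_code e u ++ y -> t = u /\ x = y.
Proof.
move=> ei; elim=> [|i t IH|t IHt t' IHt'] [|j u|u u'] x y //=.
- by move=> _ _ [->].
- by move=> [Ai At] [Aj Au] [/ei-> // /IH[]// -> ->].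
- move=> [At At'] [Au Au'] [].
  by rewrite -!catA => /IHt[]// -> /IHt'[]// -> ->.
Qed.

Lemma small_term : small I term.
Proof.
have [W [e [ei Ws]]] := small_enum smallI.
exists (fun d => term_labels (W d)); split.
- move=> d; apply: (@countable_preimage_inj _ _ (term_code (e d)) _ setT) => //.
  move=> t u At Au eq; have [|->//] := @term_code_inj (W d) (e d) (ei d) t u [::] [::] At Au.
  by rewrite !cats0.
- elim=> [|i t IH|t IHt u IHu] /=.
  + by rewrite (_ : [set d | _] = set0) //; apply/seteqP; split=> // d; apply.
  + apply: countable_sub (countable_setU (Ws i) IH) => d /= h.
    by apply: contrapT => /not_orP[/contrapT a /contrapT b]; apply: h.
  + apply: countable_sub (countable_setU IHt IHu) => d /= h.
    by apply: contrapT => /not_orP[/contrapT a /contrapT b]; apply: h.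
Qed.

Theorem precaliber_generic (P : Type) (le : P -> P -> Prop) (p0 : P)
    (D : I -> set P) :
  partial_order le -> powerfully_ccc le -> (forall i, dense_in le (D i)) ->
  exists G : set P, poset_filter le G /\ forall i, G `&` D i !=set0.
Proof.
move=> [le_refl [_ le_trans]] pccc Ddense.
have /choice[f hf] (ip : I * P) : exists q, D ip.1 q /\ le q ip.2.
  by have [q Dq qp] := Ddense ip.1 ip.2; exists q.
have /choice[g hg] (pq : P * P) : exists q, compatible le pq.1 pq.2 ->
    le q pq.1 /\ le q pq.2.
  have [[q qpq]|n] := pselect (compatible le pq.1 pq.2); first by exists q.
  by exists p0.
pose val := fix val t := match t with
  | Base => p0 | Ext i t => f (i, val t) | Meet t u => g (val t, val u) end.
pose leT t u := le (val t) (val u).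
have [||| | |t|G [[[t0 Gt0] [Gup Gdir]] GD]] :=
  @precaliber_generic_small term I leT Base (fun i => [set t | D i (val t)]).
- by move=> t; exact: le_refl.
- by move=> s t u; exact: le_trans.
(* Tuples of names with equal values are compatible, so evaluation is injective on an antichain.
   [Meet] names a lower bound of any two names with compatible values, so the image is again an
   antichain. *)
- move=> n A hA; apply: (@countable_preimage_inj _ _ (fun a j => val (a j)) A
    ((fun a j => val (a j)) @` A)).
  + move=> a b Aa Ab eab; apply: contrapT => nab; apply: (hA a b Aa Ab nab).
    exists a; split=> j; first exact: le_refl.
    have := congr1 (fun h => h j) eab; rewrite /leT => ->; exact: le_refl.
  + by move=> a Aa; exists a.
  + apply: (pccc n) => _ _ [a Aa <-] [b Ab <-] nab [z [za zb]].
    apply: (hA a b Aa Ab); first by move=> e; apply: nab; rewrite e.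
    exists (fun j => Meet (a j) (b j)).
    by split=> j; have [] := hg (val (a j), val (b j)) (ex_intro _ (z j) (conj (za j) (zb j))).
- exact: small_term.
- exact: smallI.
- by move=> t'; exists (Ext t t'); have [] := hf (t, val t').
exists [set p | exists2 t, G t & le (val t) p]; split; last first.
  by move=> i; have [t [Gt Dt]] := GD i; exists (val t); split=> //; exists t.
split; first by exists (val t0); exists t0.
split.
  by move=> p q [t Gt tp] pq; exists t => //; exact: le_trans tp pq.
move=> p q [t Gt tp] [u Gu uq]; have [v Gv [vt vu]] := Gdir t u Gt Gu.
exists (val v); first by exists v.
by split; [apply: le_trans tp|apply: le_trans uq].
Qed.

End SmallPosets.

(** * Sets of size at most aleph_1 *)

Lemma minimum_well_founded (I : Type) (lt : I -> I -> Prop) :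
  (forall B : set I, B !=set0 -> exists2 b, B b & forall c, B c -> ~ lt c b) ->
  well_founded lt.
Proof.
move=> ltmin; apply: contrapT => /existsNP[i ni].
have [b nb bmin] := ltmin [set i | ~ Acc lt i] (ex_intro _ i ni).
by apply: nb; apply: Acc_intro => c cb; apply: contrapT => /bmin.
Qed.

Lemma card_le_aleph1_small (I : Type) : card_le_aleph1 [set: I] -> small I I.
Proof.
move=> [lt [_ [_ [tot [_ seg]]]]]; exists (fun d => [set j | lt j d \/ j = d]); split.
  move=> d; apply: countable_sub (countable_setU (seg d Logic.I) (countable1 d)).
  by move=> j [h|->]; [left|right].
move=> s; apply: countable_sub (seg s Logic.I) => d /= h; split=> //.
by case: (tot s d Logic.I Logic.I) => // [?|?]; case: h; [left|right].
Qed.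

(** Recursion along the well-order: the values at earlier indices form a countable set, which does
    not exhaust [F]. *)
Lemma card_le_aleph1_inj (I T : Type) (F : set T) :
  card_le_aleph1 [set: I] -> ~ countable F ->
  exists f : I -> T, injective f /\ forall i, F (f i).
Proof.
move=> [lt [_ [_ [tot [ltmin seg]]]]] uF.
have wf : well_founded lt by apply: minimum_well_founded => B B0; exact: ltmin.
have [t0 _ _] := uncountable_avoid uF (countable0 T).
have /choice[g hg] (C : set T) : exists t, countable C -> F t /\ ~ C t.
  have [cC|nC] := pselect (countable C); last by exists t0.
  by have [t Ft nCt] := uncountable_avoid uF cC; exists t.
pose step i (rec : forall j, lt j i -> T) : T := g [set t | exists j (h : lt j i), rec j h = t].
pose f := Fix wf (fun=> T) step.
have fE i : f i = g (f @` [set j | lt j i]).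
  rewrite /f Fix_eq /step.
    congr g; apply/seteqP; split=> [t [j [h <-]]|t [j h <-]]; first by exists j.
    by exists j, h.
  move=> j u v uv; congr g; apply/seteqP; split=> t [k [h <-]]; exists k, h; exact/esym/uv || exact: uv.
have fc i : countable (f @` [set j | lt j i]).
  apply: sub_countable (card_image_le _ _) _.
  by apply: countable_sub (seg i Logic.I) => j.
have fF i : F (f i) /\ ~ (f @` [set j | lt j i]) (f i) by rewrite fE; exact: hg.
have flt i j : lt i j -> f i <> f j.
  by move=> ij e; have [_] := fF j; apply; rewrite -e; exists i.
exists f; split=> [i j e|i]; last by have [] := fF i.
by have [/flt/(_ e)|//|/flt/(_ (esym e))] := tot i j Logic.I Logic.I.
Qed.

(** Lexicographic order: first the index [rho t] of a piece containing [t], then the code within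
    that piece. An initial segment lies in countably many countable pieces. *)
Lemma card_le_aleph1_bigcup (I T : Type) (A : set T) (W : I -> set T) :
  card_le_aleph1 [set: I] -> (forall d, countable (W d)) ->
  (forall t, A t -> exists d, W d t) -> card_le_aleph1 A.
Proof.
move=> [lt [irr [tr [tot [ltmin seg]]]]] cW AW.
have [[t0 At0]|A0] := pselect (A !=set0); last first.
  have A0' t : ~ A t by move=> At; apply: A0; exists t.
  exists (fun _ _ => False); split; first by move=> t /A0'.
  split; first by move=> t u v /A0'.
  split; first by move=> t u /A0'.
  split; last by move=> t /A0'.
  by move=> B BA [b /BA/A0'].
have [d0 _] := AW t0 At0.
have /choice[rho hrho] t : exists d, A t -> W d t.
  have [At|nA] := pselect (A t); last by exists d0.
  by have [d Wd] := AW t At; exists d.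
have /choice[e ei] d : exists e : T -> nat, forall s t, W d s -> W d t -> e s = e t -> s = t.
  have /countable_injP[f fi] := cW d; exists f => s t Ws Wt.
  by apply: fi; rewrite inE.
exists (fun s t => lt (rho s) (rho t) \/ (rho s = rho t /\ e (rho s) s < e (rho t) t)).
split; first by move=> s As [/irr|[_]]; [apply|rewrite ltnn].
split.
  move=> s t u As At Au [st|[st st']] [tu|[tu tu']].
  - by left; exact: tr tu.
  - by left; rewrite -tu.
  - by left; rewrite st.
  - by right; split; [rewrite st|exact: ltn_trans st' tu'].
split.
  move=> s t As At; have [st|st|ts] := tot (rho s) (rho t) Logic.I Logic.I.
  - by apply: Or31; left.
  - have [lts|lts|est] := ltngtP (e (rho s) s) (e (rho t) t).
    + by apply: Or31; right.
    + by apply: Or33; right.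
    + apply: Or32; apply: (ei (rho s)); [exact: hrho|rewrite st; exact: hrho|].
      by rewrite est st.
  - by apply: Or33; left.
split.
  move=> B BA [b0 Bb0].
  have [d [b1 Bb1 eb1] dmin] := ltmin (rho @` B) (fun _ _ => Logic.I) (ex_intro _ _ (imageP rho Bb0)).
  have : exists n, `[< exists b, [/\ B b, rho b = d & e d b = n] >].
    by exists (e d b1); apply/asboolP; exists b1.
  move=> /ex_minnP[n /asboolP[b [Bb rb eb]] nmin]; exists b => // c Bc [cb|[rc ec]].
    by apply: (dmin (rho c)); [exists c|rewrite -rb].
  have lt_cn : e d c < n by rewrite -eb -rb -{1}rc.
  have : n <= e d c by apply: nmin; apply/asboolP; exists c; rewrite -rb.
  by rewrite leqNgt lt_cn.
move=> t At; apply: (@countable_sub _ _ (\bigcup_(d in [set j | lt j (rho t) \/ j = rho t]) W d)).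
  by move=> s [As [st|[st _]]]; exists (rho s) => //=; [left|exact: hrho|right|exact: hrho].
apply: bigcup_countable => //.
apply: countable_sub (countable_setU (seg (rho t) Logic.I) (countable1 (rho t))).
by move=> j [h|->]; [left|right].
Qed.

Lemma card_le_aleph1_sig (T : Type) (A : set T) :
  card_le_aleph1 A -> card_le_aleph1 [set: {x | A x}].
Proof.
move=> [lt [irr [tr [tot [ltmin seg]]]]].
exists (fun x y => lt (sval x) (sval y)); split; first by move=> [x Ax] _ /=; exact: irr.
split; first by move=> [x Ax] [y Ay] [z Az] _ _ _ /=; exact: tr.
split.
  move=> [x Ax] [y Ay] _ _ /=; have [?|e|?] := tot x y Ax Ay.
  - exact: Or31.
  - by apply: Or32; exact: eq_exist.
  - exact: Or33.
split.
  move=> B _ [b Bb].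
  have [||c [x Bx ex] cmin] := ltmin (sval @` B); first by move=> _ [[x Ax] _ <-].
    by exists (sval b); exists b.
  by exists x => // y By; rewrite ex; apply: cmin; exists y.
move=> [x Ax] _; apply: (@countable_preimage_inj _ _ sval _ [set j | A j /\ lt j x]).
- by move=> [y Ay] [z Az] _ _ /= e; exact: eq_exist.
- by move=> [y Ay] [_ h].
- exact: seg.
Qed.

Lemma card_le_aleph1_image (T U : Type) (f : T -> U) (A : set T) :
  card_le_aleph1 A -> card_le_aleph1 (f @` A).
Proof.
move=> /card_le_aleph1_sig cA.
apply: (card_le_aleph1_bigcup (W := fun d : {x | A x} => [set f (sval d)]) cA) => //.
by move=> _ [x Ax <-]; exists (exist _ x Ax).
Qed.

(** Well-order [T] and cut [A] at its least element with uncountably many predecessors in [A]; if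
    there is none, [A] itself has countable initial segments. *)
Lemma uncountable_aleph1 (T : Type) (A : set T) : ~ countable A ->
  exists B, [/\ B `<=` A, ~ countable B & card_le_aleph1 B].
Proof.
move=> uA; have [R woR] := @wochoice.well_ordering_principle {classic T}.
pose lt (x y : T) := R x y /\ x <> y.
have minR (B : set T) : B !=set0 -> exists2 z, B z & forall x, B x -> R z x.
  move=> [b Bb]; have [|z [[Bz zmin] _]] := woR (fun x : T => `[< B x >]).
    by exists b; apply/asboolP.
  by exists z => [|x Bx]; [exact/asboolP|apply: zmin; apply/asboolP].
(* What is given is a unique least element of each nonempty set; totality, antisymmetry and
   transitivity are read off from sets of two or three elements. *)
have tot x y : R x y \/ R y x.
  have [|z [->|->] zmin] := minR [set x; y]; first by exists x; left.
    by left; apply: zmin; right.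
  by right; apply: zmin; left.
have anti x y : R x y -> R y x -> x = y.
  move=> xy yx; have Rr z : R z z by case: (tot z z).
  have [|z [_ zu]] := woR (fun z : T => `[< z = x \/ z = y >]).
    by exists x; apply/asboolP; left.
  have zx : z = x.
    apply: zu; split; first by apply/asboolP; left.
    by move=> w /asboolP[e|e]; subst w.
  have zy : z = y.
    apply: zu; split; first by apply/asboolP; right.
    by move=> w /asboolP[e|e]; subst w.
  by rewrite -zx zy.
have trans x y z : R x y -> R y z -> R x z.
  move=> xy yz; have [|w h wmin] := minR [set t | t = x \/ t = y \/ t = z].
    by exists x; left.
  case: h => [ew|[ew|ew]]; first by rewrite -ew; apply: wmin; right; right.
    have yx : R y x by rewrite -ew; apply: wmin; left.
    by rewrite (anti x y).
  have zy : R z y by rewrite -ew; apply: wmin; right; left.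
  by rewrite -(anti y z).
have lt_trans x y z : lt x y -> lt y z -> lt x z.
  move=> [xy nxy] [yz nyz]; split; first exact: trans yz.
  by move=> e; apply: nxy; apply: anti => //; rewrite e.
have ltmin (B : set T) : B !=set0 -> exists2 b, B b & forall c, B c -> ~ lt c b.
  move=> /minR[b Bb bmin]; exists b => // c /bmin bc [cb ne].
  by apply: ne; exact: anti.
have key (B : set T) : (forall x, B x -> countable [set y | B y /\ lt y x]) ->
    card_le_aleph1 B.
  move=> cB; exists lt; split; first by move=> x _ [].
  split; first by move=> x y z _ _ _; exact: lt_trans.
  split; last by split=> // C _; exact: ltmin.
  move=> x y _ _; have [->|ne] := pselect (x = y); first exact: Or32.
  by case: (tot x y) => h; [apply: Or31|apply: Or33; split=> // e; apply: ne].
have [h|h] := pselect (exists x, A x /\ ~ countable [set y | A y /\ lt y x]).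
  have [x [Ax ux] xmin] := ltmin [set x | A x /\ ~ countable [set y | A y /\ lt y x]] h.
  exists [set y | A y /\ lt y x]; split=> //; first by move=> y [].
  apply: key => y [Ay yx]; apply: contrapT => uy; apply: (xmin y) => //.
  split=> // cy; apply: uy; apply: countable_sub cy => z [[Az _] zy].
  by split.
exists A; split=> //; apply: key => x Ax; apply: contrapT => ux; apply: h.
by exists x.
Qed.

(** * Pointwise topology *)

Lemma open_from_nbhs (T : topologicalType) (U : set T) :
  (forall x, U x -> exists V, [/\ open V, V x & V `<=` U]) -> open U.
Proof.
move=> h; rewrite openE => x /h[V [oV Vx VU]].
by apply: (filterS VU); exact: open_nbhs_nbhs.
Qed.

Lemma nbhs_open_sub (T : topologicalType) (U : set T) (x : T) :
  nbhs x U -> exists V, [/\ open V, V x & V `<=` U].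
Proof. by rewrite nbhsE => -[V [oV Vx] VU]; exists V. Qed.

Section Pointwise.
Variables (I : Type) (X : topologicalType).

(** The sets containing a box around [y] form a filter, which converges to [y] because it does so in
    every coordinate of the supremum topology. *)
Lemma ptws_open_box (U : set {ptws I -> X}) (y : {ptws I -> X}) : open U -> U y ->
  exists (l : seq I) (V : I -> set X), (forall i, open (V i) /\ V i (y i)) /\
    (forall z : {ptws I -> X}, (forall i, List.In i l -> V i (z i)) -> U z).
Proof.
move=> oU Uy.
pose G : set_system {ptws I -> X} := [set P | exists (l : seq I) (V : I -> set X),
  (forall i, open (V i) /\ V i (y i)) /\
  (forall z : {ptws I -> X}, (forall i, List.In i l -> V i (z i)) -> P z)].
have FG : Filter G.
  split.
  - exists [::], (fun=> setT); split=> // i; split=> //; exact: openT.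
  - move=> P Q [l [V [oV VP]]] [m [W [oW WQ]]].
    exists (l ++ m)%list, (fun i => V i `&` W i); split=> [i|z hz].
      have [oVi Vy] := oV i; have [oWi Wy] := oW i.
      by split; [exact: openI|].
    split; [apply: VP|apply: WQ] => i il; have [] // := hz i _;
      apply/List.in_or_app; by [left|right].
  - by move=> P Q PQ [l [V [oV VP]]]; exists l, V; split=> // z /VP/PQ.
have : G --> y.
  apply/cvg_sup => i P [_ [[W oW <-] /= Wy WP]].
  exists [:: i], (fun j => [set x | j = i -> W x]); split=> [j|z].
    split=> [|->//]; have [->|ne] := pselect (j = i).
      by rewrite (_ : [set x | _] = W) //; apply/seteqP; split=> x /=; [apply|].
    rewrite (_ : [set x | _] = setT); first exact: openT.
    by apply/seteqP; split=> x //= _ /ne.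
  by move=> h; apply: WP => /=; apply: (h i) => //; left.
by apply; exact: open_nbhs_nbhs.
Qed.

Lemma ptws_proj_continuous (i : I) : continuous (fun f : {ptws I -> X} => f i).
Proof. exact: (@proj_continuous {classic I} (fun=> X) i). Qed.

Lemma ptws_box_open (l : seq I) (V : I -> set X) : (forall i, open (V i)) ->
  open [set z : {ptws I -> X} | forall i, List.In i l -> V i (z i)].
Proof.
move=> oV; elim: l => [|i l IH].
  by rewrite (_ : [set z | _] = setT); [exact: openT|apply/seteqP; split=> // z _ i []].
rewrite (_ : [set z | _] = (fun f : {ptws I -> X} => f i) @^-1` (V i) `&`
    [set z : {ptws I -> X} | forall i, List.In i l -> V i (z i)]).
  apply: openI; last exact: IH.
  by apply: open_comp => [f _|]; [exact: ptws_proj_continuous|exact: oV].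
apply/seteqP; split=> z /=; first by move=> h; split; [|move=> j jl]; apply: h; auto.
by move=> [zi zl] j [<-//|/zl].
Qed.

Lemma ptws_continuous (Z : topologicalType) (f : Z -> {ptws I -> X}) :
  (forall i, continuous (fun z => f z i)) -> continuous f.
Proof.
move=> cf z; apply/cvg_sup => i P [_ [[W oW <-] /= Wy WP]].
have : nbhs z ((fun z => f z i) @^-1` W) by apply: cf; exact: open_nbhs_nbhs.
by move=> nW; change (nbhs z (f @^-1` P)); apply: filterS nW => w Ww; exact: WP.
Qed.

Lemma ptws_compact : compact [set: X] -> compact [set: {ptws I -> X}].
Proof.
move=> cX; have := @tychonoff {classic I} (fun=> X) (fun=> setT) (fun=> cX).
rewrite (_ : [set f | _] = setT) //.
by apply/seteqP; split.
Qed.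

Lemma ptws_hausdorff : hausdorff_space X -> hausdorff_space {ptws I -> X}.
Proof. by move=> hX; exact: (@hausdorff_product {classic I} (fun=> X) (fun=> hX)). Qed.

End Pointwise.

Lemma compact_hausdorff_regular (Y : topologicalType) (U : set Y) (y : Y) :
  compact [set: Y] -> hausdorff_space Y -> open U -> U y ->
  exists V, [/\ open V, V y & closure V `<=` U].
Proof.
move=> cY hY oU Uy.
have [B By clB] : filter_from (nbhs y) closure U.
  apply: (compact_regular hY cY); last exact: open_nbhs_nbhs.
  exact: filterT.
have [V [oV Vy VB]] := nbhs_open_sub By.
by exists V; split=> //; apply: subset_trans clB; exact: closureS.
Qed.

Lemma compact_directed_closures (Y : topologicalType) (G : set (set Y)) :
  compact [set: Y] -> G !=set0 -> (forall U, G U -> U !=set0) ->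
  (forall U V, G U -> G V -> exists2 W, G W & W `<=` U `&` V) ->
  exists y, forall U, G U -> closure U y.
Proof.
move=> cY [U0 GU0] Gne Gdir.
pose F : set_system Y := [set P | exists2 U, G U & U `<=` P].
have FF : ProperFilter F.
  split; first by move=> [U /Gne[y Uy] /(_ y Uy)].
  split; first by exists U0.
  - move=> P Q [U GU UP] [V GV VQ]; have [W GW WUV] := Gdir U V GU GV.
    by exists W => // y /WUV[/UP ? /VQ ?].
  - by move=> P Q PQ [U GU UP]; exists U => //; exact: subset_trans PQ.
have [y [_ Fy]] := cY F FF filterT.
exists y => U GU; rewrite clusterE in Fy; apply: Fy.
by exists U.
Qed.

Definition nonempty_open (Y : topologicalType) := {U : set Y | open U /\ U !=set0}.

Definition NonemptyOpen (Y : topologicalType) (U : set Y)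
  (hU : open U /\ U !=set0) : nonempty_open Y := exist _ U hU.

Definition open_le (Y : topologicalType) (U V : nonempty_open Y) : Prop :=
  sval U `<=` sval V.

Lemma open_le_partial_order (Y : topologicalType) : partial_order (@open_le Y).
Proof.
split; first by move=> U; exact: subset_refl.
split; last by move=> U V W; exact: subset_trans.
move=> [U hU] [V hV] UV VU; apply: eq_exist; exact/seteqP.
Qed.

(* Interleaving [n] points of [X^omega] turns an antichain of the [n]-th power
   of the poset of open sets into a disjoint family of open sets. *)
Lemma ptws_nat_powerfully_ccc (X : topologicalType) :
  ccc_space {ptws nat -> X} -> powerfully_ccc (@open_le {ptws nat -> X}).
Proof.
move=> cccY [|n] A hA.
  have [[f Af]|A0] := pselect (A !=set0); last first.
    by rewrite (_ : A = set0) //; apply/seteqP; split=> // f Af; apply: A0; exists f.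
  apply: countable_sub (countable1 f) => g Ag /=.
  by apply: funext => -[].
pose sub (i : 'I_n.+1) (x : {ptws nat -> X}) : {ptws nat -> X} :=
  fun k => x (k * n.+1 + i)%N.
have csub i : continuous (sub i).
  by apply: ptws_continuous => k; exact: ptws_proj_continuous.
pose Phi (f : 'I_n.+1 -> nonempty_open {ptws nat -> X}) : set {ptws nat -> X} :=
  [set x | forall i, sval (f i) (sub i x)].
have oPhi f : open (Phi f).
  rewrite openE => x fx; apply: (@filter_forall _ _ (fun i => sub i @^-1` sval (f i)) (nbhs x)) => i.
  by apply: (csub i x); apply: open_nbhs_nbhs; split; [case: (svalP (f i))|exact: fx].
have ne (f : 'I_n.+1 -> nonempty_open {ptws nat -> X}) : Phi f !=set0.
  have /choice[y hy] i : exists y, sval (f i) y by case: (f i) => U [].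
  exists (fun t => y (inord (t %% n.+1)) (t %/ n.+1)%N) => i.
  have -> : sub i (fun t => y (inord (t %% n.+1)) (t %/ n.+1)%N) = y i; last by [].
  apply: funext => k; rewrite /sub modnMDl modn_small // inord_val.
  by rewrite divnMDl // divn_small // addn0.
have meet f g : Phi f `&` Phi g !=set0 -> compatible (power_le (@open_le _) (n := n.+1)) f g.
  move=> [x [fx gx]].
  have h i : open (sval (f i) `&` sval (g i)) /\ (sval (f i) `&` sval (g i)) !=set0.
    split; first by apply: openI; [case: (svalP (f i))|case: (svalP (g i))].
    by exists (sub i x); split; [exact: fx|exact: gx].
  by exists (fun i => NonemptyOpen (h i)); split=> i; [exact: subIsetl|exact: subIsetr].
apply: (@countable_preimage_inj _ _ Phi A (Phi @` A)).
- move=> f g Af Ag e; apply: contrapT => fg; apply: (hA f g Af Ag fg).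
  by apply: meet; rewrite e setIid.
- by move=> f Af; exists f.
- apply: cccY => [_ [f _ <-]|_ _ [f Af <-] [g Ag <-] fg]; first by split.
  apply: contrapT => /eqP/set0P/meet; apply: hA => // e.
  by apply: fg; rewrite e.
Qed.

(** * Consequences of Martin's axiom for compact spaces *)

(** [A] is an antichain maximal among those inside [B], so that its members keep the property that
    defines [B]. *)
Lemma ccc_predense_countable (P : Type) (le : P -> P -> Prop) (B : set P) :
  (forall x, le x x) -> ccc_poset le -> exists A, [/\ A `<=` B, countable A &
    forall b, B b -> exists2 a, A a & compatible le a b].
Proof.
move=> le_refl ccc.
have [|A [[AB antiA] Amax]] := @Zorn_bigcup P [set A | A `<=` B /\ antichain le A].
  move=> F FP Ftot; split; first by move=> x [X FX Xx]; exact: (FP X FX).1.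
  move=> p q [X FX Xp] [Y FY Yq] pq; have [XY|YX] := Ftot X Y FX FY.
    by apply: (FP Y FY).2 => //; exact: XY.
  by apply: (FP X FX).2 => //; exact: YX.
exists A; split=> // [|b Bb]; first exact: ccc.
apply: contrapT => nb; apply: (Amax (A `|` [set b])).
  split; first by move=> x Ax; left.
  move=> /(_ b (or_intror erefl)) Ab; apply: nb; exists b => //.
  by exists b.
split; first by move=> x [/AB//|->].
move=> x y [Ax|->] [Ay|->] xy //; first exact: antiA.
  by move=> xb; apply: nb; exists x.
by move=> [z [zb zy]]; apply: nb; exists y => //; exists z.
Qed.

(** This plays the role of the uncountable cofinality of omega_1. *)
Lemma countable_cover_index (I S : Type) (W : I -> set S) (C : set S) :
  ~ countable [set: I] -> (forall s, countable [set d | ~ W d s]) -> countable C ->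
  exists d, C `<=` W d.
Proof.
move=> uI Ws cC; have cB : countable (\bigcup_(s in C) [set d | ~ W d s]).
  exact: bigcup_countable.
have [d _ nd] := uncountable_avoid uI cB.
by exists d => s Cs; apply: contrapT => nW; apply: nd; exists s.
Qed.

(** Otherwise the bad conditions, those compatible with [p i] for only countably many [i], are
    dense. A countable maximal antichain of bad conditions accounts for countably many [i]; for any
    other [i], a bad condition below [p i] is incompatible with the whole antichain. *)
Lemma ccc_frequent_below (P I : Type) (le : P -> P -> Prop) (p : I -> P) :
  (forall x, le x x) -> (forall x y z, le x y -> le y z -> le x z) ->
  ccc_poset le -> ~ countable [set: I] ->
  exists p0, forall q, le q p0 -> forall C, countable C ->
    exists2 i, ~ C i & compatible le q (p i).
Proof.
move=> le_refl le_trans ccc uI; apply: contrapT => nfreq.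
pose bad q (C : set I) := countable C /\ forall i, ~ C i -> ~ compatible le q (p i).
have dense_bad x : exists q, le q x /\ exists C, bad q C.
  apply: contrapT => nx; apply: nfreq; exists x => q qx C cC.
  apply: contrapT => ni; apply: nx; exists q; split=> //; exists C; split=> // i nCi qi.
  by apply: ni; exists i.
have [A [AB cA Apre]] := ccc_predense_countable [set q | exists C, bad q C] le_refl ccc.
have /choice[C hC] q : exists C, A q -> bad q C.
  have [/AB[C bC]|nA] := pselect (A q); first by exists C.
  by exists set0.
have cU : countable (\bigcup_(q in A) C q).
  by apply: bigcup_countable => // q /hC[].
have [i _ ni] := uncountable_avoid uI cU.
have [q [qp bq]] := dense_bad (p i).
have [a Aa [r [ra rq]]] := Apre q bq.
have [_ /(_ i)] := hC a Aa; apply; first by move=> Ci; apply: ni; exists a.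
by exists r; split=> //; exact: le_trans qp.
Qed.

Section MartinAxiom.
Hypothesis MA : MA_aleph1_powerfully_ccc.

(** Below the condition from [ccc_frequent_below], the conditions under some [p i] with [i] outside
    [W d] are dense. A filter meeting all these sets catches indices outside every [W d], while a
    countable set of indices lies in a single [W d]. *)
Lemma MA_uncountable_filter (P I : Type) (le : P -> P -> Prop) (p : I -> P) :
  partial_order le -> powerfully_ccc le ->
  card_le_aleph1 [set: I] -> ~ countable [set: I] ->
  exists2 G, poset_filter le G & ~ countable [set i | G (p i)].
Proof.
move=> po pccc aI uI; have [le_refl [le_anti le_trans]] := po.
have ccc : ccc_poset le.
  move=> A antiA.
  have := pccc 1 ((fun x (_ : 'I_1) => x) @` A).
  move=> h; apply: (@countable_preimage_inj _ _ (fun x (_ : 'I_1) => x) A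
    ((fun x (_ : 'I_1) => x) @` A)).
  - by move=> x y _ _ /(congr1 (fun f => f ord0)).
  - by move=> x Ax; exists x.
  - apply: h => _ _ [x Ax <-] [y Ay <-] xy [z [zx zy]].
    apply: (antiA x y) => //; first by move=> e; apply: xy; rewrite e.
    by exists (z ord0); split; [exact: zx|exact: zy].
have [p0 hp0] := ccc_frequent_below p le_refl le_trans ccc uI.
pose Q := {q | le q p0}.
pose leQ (x y : Q) := le (sval x) (sval y).
have [W [cW Ws]] := card_le_aleph1_small aI.
pose D d : set Q := [set q | exists2 i, ~ W d i & le (sval q) (p i)].
have [||||D' [d _ <-] q|G [[G0 [Gup Gdir]] GD]] := MA (P := Q) (le := leQ) _ _ _ (Ds := range D).
- by split; exists p0.
- split; first by move=> x; exact: le_refl.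
  split; last by move=> x y z; exact: le_trans.
  by move=> [x hx] [y hy] xy yx; apply: eq_exist; exact: le_anti.
- move=> n A antiA.
  apply: (@countable_preimage_inj _ _ (fun f i => sval (f i)) A
    ((fun f i => sval (f i)) @` A)).
  + move=> f g _ _ e; apply: funext => i.
    have : sval (f i) = sval (g i) by exact: (congr1 (fun h => h i) e).
    by case: (f i) (g i) => [x hx] [y hy] /= exy; exact: eq_exist.
  + by move=> f Af; exists f.
  + apply: pccc => _ _ [f Af <-] [g Ag <-] fg [z [zf zg]].
    apply: (antiA f g) => //; first by move=> e; apply: fg; rewrite e.
    have h i : le (z i) p0 by apply: le_trans (zf i) _; case: (f i).
    by exists (fun i => exist _ (z i) (h i)); split=> i; [exact: zf|exact: zg].
- exact: card_le_aleph1_image.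
- have [i nWi [x [xq xi]]] := hp0 (sval q) (svalP q) (W d) (cW d).
  have xp : le x p0 by exact: le_trans xq (svalP q).
  by exists (exist _ x xp) => //; exists i.
exists [set q | exists2 g, G g & le (sval g) q].
  split; first by have [g Gg] := G0; exists (sval g); exists g.
  split; first by move=> x y [g Gg gx] xy; exists g => //; exact: le_trans xy.
  move=> x y [g Gg gx] [h Gh hy]; have [k Gk [kg kh]] := Gdir g h Gg Gh.
  by exists (sval k); [exists k|split; [apply: le_trans gx|apply: le_trans hy]].
move=> cG; have [d Wd] := countable_cover_index uI Ws cG.
have [q [Gq [i nWi qi]]] := GD (D d) (ex_intro2 _ _ d Logic.I erefl).
by apply: nWi; apply: Wd; exists q.
Qed.

Section Space.
Variable Y : topologicalType.
Hypothesis cY : compact [set: Y].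
Hypothesis hY : hausdorff_space Y.
Hypothesis pcccY : powerfully_ccc (@open_le Y).

Lemma shrink_open (U : set Y) : open U -> U !=set0 ->
  exists V : nonempty_open Y, closure (sval V) `<=` U.
Proof.
move=> oU [y Uy]; have [V [oV Vy VU]] := compact_hausdorff_regular cY hY oU Uy.
by exists (NonemptyOpen (conj oV (ex_intro _ y Vy))).
Qed.

Lemma open_filter_point (G : set (nonempty_open Y)) : poset_filter (@open_le Y) G ->
  exists y, forall U, G U -> closure (sval U) y.
Proof.
move=> [[U0 GU0] [_ Gdir]].
have [|_ [U _ <-]|_ _ [U GU <-] [V GV <-]|y hy] :=
  @compact_directed_closures Y [set sval U | U in G] cY.
- by exists (sval U0); exists U0.
- by have [] := svalP U.
- by have [W GW [WU WV]] := Gdir U V GU GV; exists (sval W) => [|x Wx];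
    [exists W|split; [exact: WU|exact: WV]].
- by exists y => U GU; apply: hy; exists U.
Qed.

Lemma MA_uncountable_point (I : Type) (U : I -> set Y) :
  card_le_aleph1 [set: I] -> ~ countable [set: I] ->
  (forall i, open (U i) /\ U i !=set0) -> exists y, ~ countable [set i | U i y].
Proof.
move=> aI uI oU.
(* A filter of open sets only yields a point in their closures; shrinking beforehand puts that point
   into the [U i]. *)
have /choice[V VU] i : exists V : nonempty_open Y, closure (sval V) `<=` U i.
  by have [oUi U0] := oU i; exact: shrink_open.
have [G fG uG] := MA_uncountable_filter V (open_le_partial_order Y) pcccY aI uI.
have [y hy] := open_filter_point fG.
exists y => cy; apply: uG; apply: countable_sub cy => i /hy; exact: VU.
Qed.

Lemma MA_not_covered (F : set (set Y)) : [set: Y] !=set0 -> card_le_aleph1 F ->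
  (forall A, F A -> nowhere_dense A) -> \bigcup_(A in F) A <> [set: Y].
Proof.
move=> [y0 _] aF ndF cov.
pose D A : set (nonempty_open Y) := [set U | closure (sval U) `&` A = set0].
have [||D' [A FA <-] U|G [fG GD]] := MA (P := nonempty_open Y) (le := @open_le Y)
  _ (open_le_partial_order Y) pcccY (Ds := D @` F).
- by split; exact: NonemptyOpen (conj openT (ex_intro _ y0 Logic.I)).
- exact: card_le_aleph1_image.
- have [oU [u Uu]] := svalP U.
  have : ~ (sval U `<=` closure A).
    move=> UA; have : (closure A)° u by apply: (filterS UA); exact: open_nbhs_nbhs.
    by rewrite (ndF A FA).
  move=> /existsNP[x /not_implyP[Ux nAx]].
  have [||V VU] := @shrink_open (sval U `&` ~` closure A).
  - by apply: openI => //; apply: closed_openC; exact: closed_closure.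
  - by exists x.
  exists V; last by move=> y Vy; have [] := VU y (subset_closure Vy).
  apply/seteqP; split=> // y [/VU[_ nA] Ay]; apply: nA.
  exact: subset_closure.
have [y hy] := open_filter_point fG.
have [A FA Ay] : (\bigcup_(A in F) A) y by rewrite cov.
have [U [GU DU]] := GD (D A) (ex_intro2 _ _ A FA erefl).
have : (closure (sval U) `&` A) y by split=> //; exact: hy.
by rewrite DU.
Qed.

End Space.

End MartinAxiom.

(** * Dense metrizable subspaces *)

Local Open Scope ring_scope.

Section PartitionMetric.
Variables (T : topologicalType) (D : set T) (s : nat -> T -> T -> Prop).
Hypothesis s_refl : forall n x, D x -> s n x x.
Hypothesis s_sym : forall n x y, s n x y -> s n y x.
Hypothesis s_trans : forall n x y z, s n x y -> s n y z -> s n x z.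
Hypothesis s_dec : forall n x y, s n.+1 x y -> s n x y.
Hypothesis s_base : forall x (U : set T), D x -> open U -> U x ->
  exists n, forall y, s n x y -> U y.
Hypothesis s_open : forall n x, D x -> open [set y | s n x y].
Hypothesis s_sep : forall x y, D x -> D y -> (forall n, s n x y) -> x = y.

(** The distance is the inverse of [k.+1] for the first level [k] separating two points. Balls whose
    radius is the inverse of [n.+1] are the classes of [s n], and transitivity of each [s n] gives
    the triangle inequality. *)
Lemma partition_metrizable : metrizable_subspace D.
Proof.
have s_le n m x y : (n <= m)%N -> s m x y -> s n x y.
  elim: m => [|m IH]; first by rewrite leqn0 => /eqP->.
  by rewrite leq_eqVlt ltnS => /orP[/eqP->//|/IH h /s_dec].
have /choice[d hd] (xy : T * T) : exists r : R, ((forall n, s n xy.1 xy.2) /\ r = 0) \/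
    exists k, ~ s k xy.1 xy.2 /\ r = k.+1%:R^-1 /\ forall j, (j < k)%N -> s j xy.1 xy.2.
  have [h|h] := pselect (forall n, s n xy.1 xy.2); first by exists 0; left.
  have : exists n, ~~ `[< s n xy.1 xy.2 >].
    by move/existsNP: h => [n nn]; exists n; apply/asboolP.
  move=> /ex_minnP[k /asboolP nk kmin]; exists k.+1%:R^-1; right; exists k.
  split=> //; split=> // j jk; apply: contrapT => nj; move: jk.
  by rewrite ltnNge kmin //; apply/asboolP.
have inv_lt n k : (n.+1%:R^-1 < k.+1%:R^-1 :> R) = (k < n)%N.
  by rewrite ltf_pV2 ?posrE ?ltr0n // ltr_nat ltnS.
have dP n x y : d (x, y) < n.+1%:R^-1 <-> s n x y.
  have [[/= h ->]|[k /= [nk [-> kmin]]]] := hd (x, y).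
    by split=> // _; rewrite invr_gt0 ltr0n.
  rewrite inv_lt; split=> [|sn]; first exact: kmin.
  by rewrite ltnNge; apply/negP => kn; apply: nk; exact: s_le sn.
have d_ge0 x y : 0 <= d (x, y).
  by have [[_ ->]|[k [_ [-> _]]]] := hd (x, y); rewrite ?invr_ge0 ?ler0n.
have d_le x y (r : R) : 0 <= r -> (forall n, r < n.+1%:R^-1 -> s n x y) -> d (x, y) <= r.
  move=> r0 h; have [[_ ->]//|[k /= [nk [-> _]]]] := hd (x, y).
  by rewrite leNgt; apply/negP => /h.
exists (fun x y => d (x, y)); split.
  move=> x y Dx Dy; split=> [d0|->].
    by apply: s_sep => // n; apply/dP; rewrite d0 invr_gt0 ltr0n.
  by apply/eqP; rewrite eq_le d_ge0 andbT; apply: d_le => // n _; exact: s_refl.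
split.
  move=> x y Dx Dy; apply/eqP; rewrite eq_le.
  by rewrite !d_le // => n /dP/s_sym.
split.
  move=> x y z Dx Dy Dz; apply: d_le => [|n lt]; first exact: addr_ge0.
  apply: (@s_trans _ _ y); apply/dP; apply: le_lt_trans lt.
    by rewrite lerDl.
  by rewrite lerDr.
move=> U; split.
  move=> [V [oV ->]]; split; first by move=> x [].
  move=> x [Dx Vx]; have [n hn] := s_base Dx oV Vx.
  exists n.+1%:R^-1; first by rewrite invr_gt0 ltr0n.
  by move=> y [Dy /dP/hn].
move=> [UD hU].
(* The ambient open set inducing [U] is the union of the classes of points of [U] whose trace on [D]
   stays in [U]. *)
exists [set z | exists x n, [/\ U x, s n x z & forall y, D y -> s n x y -> U y]].
split.
  apply: open_from_nbhs => z [x [n [Ux sz h]]].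
  exists [set y | s n x y]; split=> //; first by apply: s_open; exact: UD.
  by move=> y sy; exists x, n.
apply/seteqP; split=> [x Ux|x [Dx [y [n [Uy sx h]]]]]; last exact: h.
split; first exact: UD.
have [e e0 he] := hU x Ux.
have [n ne] : exists n, n.+1%:R^-1 < e.
  have := archi_boundP (ltW (ltac:(by rewrite invr_gt0) : 0 < e^-1)) => lt.
  exists (Num.bound e^-1); rewrite invf_plt ?posrE ?ltr0n //.
  by apply: lt_trans lt _; rewrite ltr_nat.
exists x, n; split=> //; first exact/s_refl/UD.
by move=> y Dy /dP lt; apply: he; split=> //; exact: lt_trans ne.
Qed.

End PartitionMetric.

Definition countable_character (Y : topologicalType) (x : Y) := exists O : nat -> set Y,
  [/\ forall n, open (O n) /\ O n x, forall n, O n.+1 `<=` O n &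
      forall U, open U -> U x -> exists n, O n `<=` U].

Section DenseMetrizable.
Variable Y : topologicalType.
Hypothesis hY : hausdorff_space Y.
Hypothesis charY : forall U : set Y, open U -> U !=set0 ->
  exists2 x, U x & countable_character x.
Variable V : nat -> set (set Y).
Hypothesis V_open : forall m v, V m v -> open v.
Hypothesis V_disj : forall m v w, V m v -> V m w -> v `&` w !=set0 -> v = w.
Hypothesis V_base : forall U : set Y, open U -> U !=set0 ->
  exists m v, [/\ V m v, v !=set0 & v `<=` U].

(** Adding the exterior of the union keeps the family disjoint and makes every nonempty open set
    meet a member. *)
Let Vc m : set (set Y) := V m `|` [set ~` closure (\bigcup_(v in V m) v)].

Fixpoint cells n : set (set Y) := match n with
  | 0 => Vc 0
  | n.+1 => [set A | exists B C, [/\ cells n B, Vc n.+1 C & A = B `&` C]] end.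

Let Vc_open m A : Vc m A -> open A.
Proof.
move=> [/V_open//|->]; apply: closed_openC; exact: closed_closure.
Qed.

Let Vc_sub m v A : V m v -> Vc m A -> v `&` A !=set0 -> A = v.
Proof.
move=> mv [mA|->] [x [vx Ax]]; first by apply: V_disj mA mv _; exists x.
by exfalso; apply: Ax; apply: subset_closure; exists v.
Qed.

Let Vc_disj m A B : Vc m A -> Vc m B -> A `&` B !=set0 -> A = B.
Proof.
move=> [mA|->] mB AB; first by rewrite (Vc_sub mA mB AB).
case: mB AB => [mB|->//] AB; apply: (Vc_sub mB); first by right.
by rewrite setIC.
Qed.

Let Vc_dense m U : open U -> U !=set0 -> exists2 A, Vc m A & U `&` A !=set0.
Proof.
move=> oU [x Ux]; have [[v [mv vU]]|h] := pselect (exists v, V m v /\ U `&` v !=set0).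
  by exists v => //; left.
exists (~` closure (\bigcup_(v in V m) v)); first by right.
exists x; split=> // /(_ U (open_nbhs_nbhs (conj oU Ux)))[y [[v mv vy] Uy]].
by apply: h; exists v; split=> //; exists y.
Qed.

Lemma cells_open n A : cells n A -> open A.
Proof.
elim: n A => [|n IH] A; first exact: Vc_open.
by move=> [B [C [/IH oB /Vc_open oC ->]]]; exact: openI.
Qed.

Lemma cells_disj n A B : cells n A -> cells n B -> A `&` B !=set0 -> A = B.
Proof.
elim: n A B => [|n IH] A B; first exact: Vc_disj.
move=> [A1 [A2 [h1 h2 ->]]] [B1 [B2 [k1 k2 ->]]] [x [[a1 a2] [b1 b2]]].
have -> : A1 = B1 by apply: IH => //; exists x.
have -> : A2 = B2 by apply: (Vc_disj h2 k2); exists x.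
by [].
Qed.

Lemma cells_dense n U : open U -> U !=set0 -> exists2 A, cells n A & U `&` A !=set0.
Proof.
elim: n U => [|n IH] U oU U0; first exact: Vc_dense.
have [B nB UB] := IH U oU U0.
have [C nC UC] := @Vc_dense n.+1 _ (openI oU (cells_open nB)) UB.
by exists (B `&` C); [exists B, C|rewrite setIA].
Qed.

(** A cell is an intersection with one factor for each level up to [n]; if it meets [v], its factor
    at level [m] can only be [v]. *)
Lemma cells_refine n m A v : (m <= n)%N -> cells n A -> V m v -> v `&` A !=set0 ->
  A `<=` v.
Proof.
elim: n A => [|n IH] A.
  by rewrite leqn0 => /eqP-> nA mv vA; rewrite (Vc_sub mv nA vA).
rewrite leq_eqVlt ltnS => /orP[/eqP->|mn] [B [C [nB nC ->]]] mv [x [vx [Bx Cx]]].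
  by rewrite (Vc_sub mv nC) //; exists x.
have Bv : B `<=` v by apply: (IH B mn nB mv); exists x.
by apply: subset_trans Bv; exact: subIsetl.
Qed.

Variables (pt : set Y -> Y) (O : Y -> nat -> set Y).
Hypothesis ptP : forall U, open U -> U !=set0 -> U (pt U) /\ countable_character (pt U).
Hypothesis OP : forall x, countable_character x ->
  [/\ forall n, open (O x n) /\ O x n x, forall n, O x n.+1 `<=` O x n &
      forall U, open U -> U x -> exists n, O x n `<=` U].
Variable y0 : Y.

(* A tree of pointed open sets: at stage [n] a node [(w, x)] keeps [x] in its
   child [w `&` O x n], and the rest of [w] is cut into cells, each receiving a
   new point. *)
Fixpoint stage n : set (set Y * Y) := match n with
  | 0 => [set (setT, pt setT)]
  | n.+1 => [set b | exists w x, stage n (w, x) /\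
      (b = (w `&` O x n, x) \/ exists A, [/\ cells n A,
         A `&` (w `&` ~` closure (O x n)) !=set0 &
         b = (A `&` (w `&` ~` closure (O x n)), pt (A `&` (w `&` ~` closure (O x n))))])] end.

Lemma stageP n w x : stage n (w, x) -> [/\ open w, w x & countable_character x].
Proof.
elim: n w x => [|n IH] w x.
  move=> [-> ->]; have [|? ?] := @ptP setT openT; first by exists y0.
  by split=> //; exact: openT.
move=> [w' [x' [/IH[ow wx cx]]]] [[-> ->]|[A [nA A0 [-> ->]]]].
  have [oO _ _] := OP cx; have [oOn On] := oO n.
  by split=> //; exact: openI.
have oA : open (A `&` (w' `&` ~` closure (O x' n))).
  apply: openI; first exact: cells_open nA.
  by apply: openI => //; apply: closed_openC; exact: closed_closure.
by have [? ?] := ptP oA A0.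
Qed.

Lemma stage_keep n w x : stage n (w, x) -> stage n.+1 (w `&` O x n, x).
Proof. by move=> h; exists w, x; split=> //; left. Qed.

Lemma stage_parent n w x : stage n.+1 (w, x) ->
  exists w' x', stage n (w', x') /\ w `<=` w'.
Proof.
move=> [w' [x' [h]]] [[-> _]|[A [_ _ [-> _]]]]; exists w', x'; split=> //.
by move=> y [_ []].
Qed.

Lemma stage_disj n w x w' x' : stage n (w, x) -> stage n (w', x') ->
  w `&` w' !=set0 -> w = w' /\ x = x'.
Proof.
elim: n w x w' x' => [|n IH] w x w' x'; first by move=> [-> ->] [-> ->].
move=> [u [a [hu hw]]] [u' [a' [hu' hw']]] [z [wz w'z]].
have uz : u z by case: hw wz => [[-> _]|[A [_ _ [-> _]]]] => [[]//|[_ []]].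
have u'z : u' z by case: hw' w'z => [[-> _]|[A [_ _ [-> _]]]] => [[]//|[_ []]].
have [euu eaa] := IH _ _ _ _ hu hu' (ex_intro _ z (conj uz u'z)); subst u' a'.
case: hw wz => [[-> ->]|[A [nA A0 [-> ->]]]];
  case: hw' w'z => [[-> ->]|[A' [nA' A'0 [-> ->]]]] //.
- by move=> [_ [_ nO]] [_ Oz]; case: nO; exact: subset_closure.
- by move=> [_ Oz] [_ [_ nO]]; case: nO; exact: subset_closure.
- move=> [A'z _] [Az _]; have -> : A = A' by apply: (cells_disj nA nA'); exists z.
  by [].
Qed.

Lemma stage_dense n U : open U -> U !=set0 -> exists w x, stage n (w, x) /\ U `&` w !=set0.
Proof.
elim: n U => [|n IH] U oU U0; first by exists setT, (pt setT); rewrite setIT.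
have [w [x [h Uw]]] := IH U oU U0; have [ow _ cx] := stageP h.
have [[z [[Uz wz] Oz]]|nO] := pselect ((U `&` w) `&` O x n !=set0).
  by exists (w `&` O x n), x; split; [exact: stage_keep|exists z].
have oUw := openI oU ow.
have [A nA [z [[Uz wz] Az]]] := @cells_dense n _ oUw Uw.
have nz : (w `&` ~` closure (O x n)) z.
  split=> // /(_ _ (open_nbhs_nbhs (conj oUw (conj Uz wz))))[t [Ot Ut]].
  by apply: nO; exists t.
exists (A `&` (w `&` ~` closure (O x n))), (pt (A `&` (w `&` ~` closure (O x n)))).
split; last by exists z.
by exists w, x; split=> //; right; exists A; split=> //; exists z.
Qed.

Let D : set Y := [set x | exists n w, stage n (w, x)].

Let same n x y := exists w z, [/\ stage n (w, z), w x & w y].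

Let D_stage x : D x -> exists n0, forall n, (n0 <= n)%N -> exists w, stage n (w, x).
Proof.
move=> [n0 [w0 h0]]; exists n0; elim=> [|n IH]; first by rewrite leqn0 => /eqP<-; exists w0.
rewrite leq_eqVlt ltnS => /orP[/eqP<-|/IH[w h]]; first by exists w0.
by exists (w `&` O x n); exact: stage_keep.
Qed.

Let D_cover x n : D x -> exists w z, stage n (w, z) /\ w x.
Proof.
move=> Dx; have [n0 /(_ _ (leq_maxl n0 n))[w h]] := D_stage Dx.
have [_ wx _] := stageP h.
have : exists w z, stage (maxn n0 n) (w, z) /\ w x by exists w, x.
move: (leq_maxr n0 n); elim: (maxn n0 n) => [|k IH].
  by rewrite leqn0 => /eqP->.
rewrite leq_eqVlt ltnS => /orP[/eqP->//|nk] [u [z [/stage_parent[u' [z' [h' uu']]] ux]]].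
by apply: (IH nk); exists u', z'; split=> //; exact: uu'.
Qed.

Lemma stage_points_dense : dense D.
Proof.
move=> U U0 oU; have [m [v [mv v0 vU]]] := V_base oU U0.
suff [x Dx vx] : exists2 x, D x & v x by exists x; split=> //; exact: vU.
apply: contrapT => nD.
have ov := V_open mv.
(* If [v] left the closure of [O x n] inside [w], some cell would meet [v] there and hence lie in
   [v] by [cells_refine]; the new point placed at the next stage would then belong to [v]. *)
have tight n w x : (m <= n)%N -> stage n (w, x) -> v `&` w `<=` closure (O x n).
  move=> mn h z [vz wz]; apply: contrapT => nz; have [ow _ _] := stageP h.
  have oE : open (v `&` (w `&` ~` closure (O x n))).
    apply: openI => //; apply: openI => //; apply: closed_openC; exact: closed_closure.
  have [|A nA [t [[vt et] At]]] := @cells_dense n _ oE; first by exists z.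
  have Av : A `<=` v by apply: (cells_refine mn nA mv); exists t.
  have ne : A `&` (w `&` ~` closure (O x n)) !=set0 by exists t.
  have oA : open (A `&` (w `&` ~` closure (O x n))).
    apply: openI; first exact: cells_open nA.
    by apply: openI => //; apply: closed_openC; exact: closed_closure.
  have [[/Av vp _] _] := ptP oA ne.
  apply: nD; exists (pt (A `&` (w `&` ~` closure (O x n)))) => //.
  exists n.+1, (A `&` (w `&` ~` closure (O x n))), w, x; split=> //.
  by right; exists A.
have [w [x [h [z [vz wz]]]]] := stage_dense m ov v0.
have [_ _ cx] := stageP h; have [oO Odec Obase] := OP cx.
have zx : z != x.
  by apply/eqP => e; apply: nD; exists x; [exists m, w|rewrite -e].
have Odec' n k : (n <= k)%N -> O x k `<=` O x n.
  elim: k => [|k IH]; first by rewrite leqn0 => /eqP->.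
  rewrite leq_eqVlt ltnS => /orP[/eqP->//|/IH]; exact: subset_trans (Odec k).
have [N nzN] : exists N, ~ closure (O x N) z.
  have /= := hY; rewrite open_hausdorff => /(_ z x zx)[[A B] /= [+ +] [oA oB AB]].
  rewrite !inE => Az Bx; have [N NB] := Obase B oB Bx.
  exists N => /(_ A (open_nbhs_nbhs (conj oA Az)))[t [/NB Bt At]].
  by have : (A `&` B) t by []; rewrite (eqP AB).
have oU' : open (v `&` ~` closure (O x N)).
  by apply: openI => //; apply: closed_openC; exact: closed_closure.
(* The node keeping [x] never stops meeting the part of [v] outside the closure of [O x N]: by
   [tight], [v] within the node lies in the closure of [O x (m + k)], so the next node meets that
   part too. At [k = N] this contradicts [tight]. *)
have chain k : exists w, stage (m + k) (w, x) /\ (v `&` ~` closure (O x N)) `&` w !=set0.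
  elim: k => [|k [wk [hk [t [[vt nt] wt]]]]]; first by exists w; rewrite addn0; split=> //; exists z.
  exists (wk `&` O x (m + k)); rewrite addnS; split; first exact: stage_keep.
  have [owk _ _] := stageP hk.
  have := tight _ _ _ (leq_addr k m) hk t (conj vt wt).
  move=> /(_ _ (open_nbhs_nbhs (conj (openI oU' owk) (conj (conj vt nt) wt)))).
  by move=> [t' [Ot' [vt' wt']]]; exists t'.
have [wN [hN [t [[vt nt] wt]]]] := chain N; apply: nt.
apply: (@closureS _ (O x (m + N))); first exact: Odec' (leq_addl _ _).
exact: tight (leq_addr N m) hN t (conj vt wt).
Qed.

(** The partitions are those into nodes. Once [x] has appeared, later nodes keeping it lie inside
    ever smaller [O x k], which yields the topology at the points of [D]. *)
Lemma stage_points_metrizable : metrizable_subspace D.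
Proof.
have base x U : D x -> open U -> U x -> exists n, forall y, same n x y -> U y.
  move=> Dx oU Ux; have [n0 hn0] := D_stage Dx.
  have [_ [_ /stageP[_ _ cx]]] := Dx; have [oO Odec Obase] := OP cx.
  have Odec' n k : (n <= k)%N -> O x k `<=` O x n.
    elim: k => [|k IH]; first by rewrite leqn0 => /eqP->.
    rewrite leq_eqVlt ltnS => /orP[/eqP->//|/IH]; exact: subset_trans (Odec k).
  have [k kU] := Obase U oU Ux.
  have [w h] := hn0 _ (leq_maxl n0 k).
  exists (maxn n0 k).+1 => y [w' [z [h' w'x w'y]]].
  have [_ wx _] := stageP (stage_keep h).
  have [ew _] := stage_disj (stage_keep h) h' (ex_intro _ x (conj wx w'x)).
  move: w'y; rewrite -ew => -[_ Oy]; apply: kU.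
  exact: Odec' (leq_maxr n0 k) _ Oy.
apply: (@partition_metrizable _ _ same).
- by move=> n x /(D_cover n)[w [z [h wx]]]; exists w, z.
- by move=> n x y [w [z [h wx wy]]]; exists w, z.
- move=> n x y z [w [a [h wx wy]]] [w' [a' [h' w'y w'z]]].
  have [ew _] := stage_disj h h' (ex_intro _ y (conj wy w'y)).
  by exists w, a; split=> //; rewrite ew.
- move=> n x y [w [z [/stage_parent[w' [z' [h' ww']]] wx wy]]].
  by exists w', z'; split=> //; exact: ww'.
- exact: base.
- move=> n x Dx; have [w [z [h wx]]] := D_cover n Dx; have [ow _ _] := stageP h.
  rewrite (_ : [set y | _] = w) //; apply/seteqP; split=> y.
    move=> [w' [z' [h' w'x w'y]]].
    by have [-> _] := stage_disj h h' (ex_intro _ x (conj wx w'x)).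
  by move=> wy; exists w, z.
- move=> x y Dx Dy sxy; apply: contrapT => /eqP xy.
  have /= := hY; rewrite open_hausdorff => /(_ x y xy)[[A B] /= [+ +] [oA oB AB]].
  rewrite !inE => Ax By; have [n hn] := base x A Dx oA Ax.
  have : (A `&` B) y by split=> //; exact: hn.
  by rewrite (eqP AB).
Qed.

End DenseMetrizable.

(** * Corson compacta *)

Lemma R_open_ball (V : set R) (c : R) : open V -> V c ->
  exists2 e : R, 0 < e & forall r, `|r - c| < e -> V r.
Proof.
move=> oV Vc; have /nbhs_ballP[e /= e0 he] := open_nbhs_nbhs (conj oV Vc).
by exists e => // r rc; apply: he; rewrite /ball /= distrC.
Qed.

Lemma R_ball_open (c e : R) : open [set r : R | `|r - c| < e].
Proof.
apply: open_from_nbhs => x /= xe.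
suff /nbhs_open_sub : nbhs x [set r : R | `|r - c| < e] by [].
apply/nbhs_ballP; exists (e - `|x - c|) => /=; first by rewrite subr_gt0.
move=> r; rewrite /ball /= distrC => rx.
have -> : r - c = (r - x) + (x - c) by rewrite addrA subrK.
by apply: le_lt_trans (ler_normD _ _) _; rewrite -ltrBrDr.
Qed.

Lemma R_coball_open (c e : R) : open [set r : R | e < `|r - c|].
Proof.
apply: open_from_nbhs => x /= xe.
exists [set r : R | `|r - x| < `|x - c| - e]; split; first exact: R_ball_open.
  by rewrite /= subrr normr0 subr_gt0.
move=> r /= rx; have : `|x - c| <= `|r - x| + `|r - c|.
  have -> : x - c = - (r - x) + (r - c) by rewrite opprB addrA subrK.
  by apply: le_trans (ler_normD _ _) _; rewrite normrN.
by lra.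
Qed.

Lemma R_hausdorff : hausdorff_space R.
Proof.
rewrite open_hausdorff => x y xy.
have d0 : 0 < `|x - y| by rewrite normr_gt0 subr_eq0.
exists ([set r : R | `|r - x| < `|x - y| / 2], [set r : R | `|r - y| < `|x - y| / 2]).
  by rewrite !inE /= !subrr normr0 divr_gt0 // ltr0n.
split; [exact: R_ball_open|exact: R_ball_open|].
apply/eqP/seteqP; split=> // r [/= rx ry].
have : `|x - y| <= `|r - x| + `|r - y|.
  have -> : x - y = - (r - x) + (r - y) by rewrite opprB addrA subrK.
  by apply: le_trans (ler_normD _ _) _; rewrite normrN.
by lra.
Qed.

Lemma corson_of_injection (X : topologicalType) (K : Type) (e : X -> {ptws K -> R}) :
  compact [set: X] -> continuous e -> injective e ->
  (forall x, countable [set k | e x k <> 0]) -> corson_compact X.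
Proof.
move=> cX ce ie se.
have hR : hausdorff_space {ptws K -> R} by apply: ptws_hausdorff; exact: R_hausdorff.
split=> //; split.
  rewrite open_hausdorff => x y xy.
  have := hR; rewrite open_hausdorff => /(_ (e x) (e y)) [].
    by apply: contra_neq xy => /ie.
  move=> [A B] /= [+ +] [oA oB AB]; rewrite !inE => Ax By.
  exists (e @^-1` A, e @^-1` B); first by rewrite !inE.
  split; try by apply: open_comp => // z _; exact: ce.
  by rewrite -preimage_setI (eqP AB) preimage_set0.
exists K, e; do 3!split=> //.
move=> U oU; exists (~` (e @` ~` U)).
  apply: closed_openC; apply: compact_closed => //.
  apply: continuous_compact; first exact: continuous_subspaceT.
  apply: subclosed_compact cX _ => //; exact: open_closedC.
apply/seteqP; split=> [_ [x Ux <-]|_ [[x _ <-] nx]].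
  by split; [exists x|move=> [y nUy /ie exy]; apply: nUy; rewrite exy].
by exists x => //; apply: contrapT => nUx; apply: nx; exists x.
Qed.

Lemma corson_ptws_nat (X : topologicalType) :
  corson_compact X -> corson_compact {ptws nat -> X}.
Proof.
move=> [cX [hX [K [e [ce [ie [oe se]]]]]]].
pose e' (y : {ptws nat -> X}) : {ptws K * nat -> R} := fun kn => e (y kn.2) kn.1.
apply: (@corson_of_injection _ _ e').
- exact: ptws_compact.
- apply: ptws_continuous => -[k n] /=; rewrite /e' /= => y.
  apply: (@continuous_comp _ _ _ (fun y : {ptws nat -> X} => y n) (fun x => e x k)).
    exact: ptws_proj_continuous.
  apply: (@continuous_comp _ _ _ e (fun f : {ptws K -> R} => f k)); first exact: ce.
  exact: ptws_proj_continuous.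
- move=> y z yz; apply: funext => n; apply: ie; apply: funext => k.
  exact: (congr1 (fun f : {ptws K * nat -> R} => f (k, n)) yz).
- move=> y; apply: (@countable_sub _ _
    (\bigcup_(n in [set: nat]) ((fun k => (k, n)) @` [set k | e (y n) k <> 0]))).
    by move=> [k n] h; exists n => //; exists k.
  apply: bigcup_countable => // n _.
  exact: sub_countable (card_image_le _ _) (se _).
Qed.

(** With closures nested in the previous sets, the [O n] shrink to [y]. If none were inside [U], a
    cluster point of the sets [O n] minus [U] would be a second point of their intersection. *)
Lemma gdelta_countable_character (Y : topologicalType) (G : set (set Y)) (y : Y) :
  compact [set: Y] -> hausdorff_space Y -> countable G ->
  (forall U, G U -> open U /\ U y) ->
  (forall z, (forall U, G U -> U z) -> z = y) -> countable_character y.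
Proof.
move=> cY hY /countable_injP[f fi] Go Gy.
have /choice[g hg] n : exists U, [/\ open U, U y & forall V, G V -> f V = n -> U = V].
  have [[U [GU fU]]|h] := pselect (exists U, G U /\ f U = n).
    have [oU Uy] := Go U GU; exists U; split=> // V GV fV.
    by apply: fi; rewrite ?inE // fU.
  exists setT; split=> //; first exact: openT.
  by move=> V GV fV; case: h; exists V.
have /choice[sh hsh] U : exists V, open U /\ U y -> [/\ open V, V y & closure V `<=` U].
  have [[oU Uy]|n] := pselect (open U /\ U y); last by exists setT.
  by have [V h] := compact_hausdorff_regular cY hY oU Uy; exists V.
pose O := fix O n := match n with 0%N => setT | n.+1 => sh (O n `&` g n) end.
have OP n : open (O n) /\ O n y.
  elim: n => [|n [oO Oy]]; first by split=> //; exact: openT.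
  have [og gy _] := hg n.
  by have [] := hsh (O n `&` g n) (conj (openI oO og) (conj Oy gy)).
have Osub n : closure (O n.+1) `<=` O n `&` g n.
  have [og gy _] := hg n; have [oO Oy] := OP n.
  by have [] := hsh (O n `&` g n) (conj (openI oO og) (conj Oy gy)).
have Odec n : O n.+1 `<=` O n by move=> z /subset_closure/Osub[].
exists O; split=> // U oU Uy.
have Odec' n k : (n <= k)%N -> O k `<=` O n.
  elim: k => [|k IH]; first by rewrite leqn0 => /eqP->.
  rewrite leq_eqVlt ltnS => /orP[/eqP->//|/IH]; exact: subset_trans (Odec k).
apply: contrapT => nU.
pose F : set_system Y := [set P | exists n, O n `&` ~` U `<=` P].
have FF : ProperFilter F.
  split.
    move=> [n h]; apply: nU; exists n => z Oz; apply: contrapT => nUz.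
    exact: (h z (conj Oz nUz)).
  split; first by exists 0%N.
  - move=> P Q [n hn] [m hm]; exists (maxn n m) => z [Oz nUz].
    by split; [apply: hn|apply: hm]; split=> //; apply: Odec' Oz; rewrite (leq_maxl, leq_maxr).
  - by move=> P Q PQ [n hn]; exists n; exact: subset_trans PQ.
have [z [_ Fz]] := cY F FF filterT; rewrite clusterE in Fz.
have zO n : O n z /\ g n z.
  apply: Osub; have /Fz : F (O n.+1) by exists n.+1 => t [].
  by [].
have : z = y.
  apply: Gy => V GV; have [_ _ /(_ V GV erefl) <-] := hg (f V).
  by have [] := zO (f V).
move=> ezy; have /Fz : F (~` U) by exists 0%N => t [].
have <- : ~` U = closure (~` U) by apply/closure_id; exact: open_closedC.
by rewrite ezy.
Qed.

Lemma archi_invS (e : R) : 0 < e -> exists n : nat, n.+1%:R^-1 < e.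
Proof.
move=> e0; have e0' : 0 < e^-1 by rewrite invr_gt0.
have lt := archi_boundP (ltW e0').
exists (Num.bound e^-1); rewrite invf_plt ?posrE ?ltr0n //.
by apply: lt_trans lt _; rewrite ltr_nat.
Qed.

Lemma norm_le_invS_eq0 (a b : R) : 0 <= b ->
  (forall n : nat, `|a| < b + n.+1%:R^-1) -> `|a| <= b.
Proof.
move=> b0 h; rewrite leNgt; apply/negP => lt.
have [n hn] := @archi_invS (`|a| - b) (ltac:(by rewrite subr_gt0)).
suff : `|a| < `|a| by rewrite ltxx.
by apply: lt_trans (h n) _; rewrite -ltrBrDl.
Qed.

Lemma itv_ballE (a b x : R) : (a < x < b) = (`|x - (a + b) / 2| < (b - a) / 2).
Proof.
by rewrite ltr_norml; apply/andP/andP => -[? ?]; split; lra.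
Qed.

Section CorsonCharacter.
Variables (Y : topologicalType) (K : Type) (e : Y -> {ptws K -> R}).
Hypothesis cY : compact [set: Y].
Hypothesis hY : hausdorff_space Y.
Hypothesis ce : continuous e.
Hypothesis ie : injective e.
Hypothesis oe : forall U : set Y, open U ->
  exists2 V : set {ptws K -> R}, open V & e @` U = range e `&` V.
Hypothesis se : forall x, countable [set k | e x k <> 0].

Lemma corson_coordinate_open (k : K) (W : set R) : open W -> open [set y | W (e y k)].
Proof.
move=> oW; apply: (@open_comp _ _ (fun y => e y k) W) => // y _.
apply: (@continuous_comp _ _ _ e (fun f : {ptws K -> R} => f k)); first exact: ce.
exact: ptws_proj_continuous.
Qed.

Lemma corson_ball_open (k : K) (c d : R) : open [set y | `|e y k - c| < d].
Proof. exact: (@corson_coordinate_open k _ (@R_ball_open c d)). Qed.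

Lemma corson_coball_open (k : K) (c d : R) : open [set y | d < `|e y k - c|].
Proof. exact: (@corson_coordinate_open k _ (@R_coball_open c d)). Qed.

Lemma corson_open_box (U : set Y) (u : Y) : open U -> U u ->
  exists (l : seq K) (d : R), 0 < d /\
    forall y, (forall k, List.In k l -> `|e y k - e u k| < d) -> U y.
Proof.
move=> oU Uu; have [V oV eU] := oe oU.
have [_ Veu] : (range e `&` V) (e u) by rewrite -eU; exists u.
have [l [W [oW WV]]] := ptws_open_box oV Veu.
have [d d0 hd] : exists2 d : R, 0 < d &
    forall k, List.In k l -> forall r, `|r - e u k| < d -> W k r.
  elim: l {WV} => [|k l [d d0 hd]]; first by exists 1.
  have [oWk Wk] := oW k; have [d' d'0 hd'] := R_open_ball oWk Wk.
  exists (Num.min d d'); first by rewrite lt_min d0.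
  move=> j [<-|jl] r; rewrite lt_min => /andP[rd rd']; first exact: hd'.
  exact: hd jl _ rd.
exists l, d; split=> // y hy.
have [z Uz /ie <-//] : (e @` U) (e y).
  by rewrite eU; split; [exists y|apply: WV => k kl; apply: hd kl _ (hy k kl)].
Qed.

(** In a closed [F] inside [U], take by Zorn a point [y] maximal for extension: larger points agree
    with it on its support. By maximality, no other point of [F] agrees with [y] there. As the
    support is countable, [y] is a G-delta point. *)
Lemma corson_countable_character (U : set Y) : open U -> U !=set0 ->
  exists2 x, U x & countable_character x.
Proof.
move=> oU [u Uu]; have [l [d [d0 hd]]] := corson_open_box oU Uu.
pose F := [set y | forall k, List.In k l -> `|e y k - e u k| <= d / 2].
have FU : F `<=` U.
  move=> y Fy; apply: hd => k kl; apply: le_lt_trans (Fy k kl) _.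
  by lra.
have clF : closed F.
  rewrite -[F]setCK; apply: open_closedC; apply: open_from_nbhs => y.
  move=> /existsNP[k /not_implyP[kl /negP]]; rewrite -ltNge => lt.
  exists [set z | d / 2 < `|e z k - e u k|]; split=> //.
    exact: corson_coball_open.
  by move=> z /= zlt /(_ k kl); rewrite leNgt zlt.
have Fu : F u by move=> k _; rewrite subrr normr0; lra.
have cF : compact F by apply: subclosed_compact clF cY _.
pose ext (x y : Y) := forall k, e x k <> 0 -> e y k = e x k.
pose T := {y | F y}.
have [||A Atot|[y Fy] ymax] := @ZL_preorder T (exist _ u Fu)
  (fun x y => `[< ext (sval x) (sval y) >]).
- by move=> x; apply/asboolP.
- move=> x y z /asboolP yx /asboolP xz; apply/asboolP => k yk.
  by rewrite -(yx k yk) xz // (yx k yk).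
- have [[a0 Aa0]|A0] := pselect (A !=set0); last first.
    by exists (exist _ u Fu) => s As; case: A0; exists s.
  (* A chain is bounded by a cluster point of its tails: at a coordinate in the support of [a] all
     later members share the value of [a], hence so does the cluster point. *)
  pose G : set_system Y := [set P | exists2 a, A a &
    forall b, A b -> ext (sval a) (sval b) -> P (sval b)].
  have FG : ProperFilter G.
    split; first by move=> [a Aa /(_ a Aa)]; apply.
    split; first by exists a0.
    + move=> P Q [a Aa aP] [b Ab bQ].
      have [/asboolP ab|/asboolP ba] := Atot a b Aa Ab.
        exists b => // c Ac bc; split; last exact: bQ.
        apply: aP => // k ak; have eb := ab k ak; rewrite -eb; apply: bc.
        by rewrite eb.
      exists a => // c Ac ac; split; first exact: aP.
      apply: bQ => // k bk; have ea := ba k bk; rewrite -ea; apply: ac.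
      by rewrite ea.
    + by move=> P Q PQ [a Aa aP]; exists a => // b Ab /aP-/(_ Ab)/PQ.
  have [z [Fz Gz]] : F `&` cluster G !=set0.
    by apply: cF; exists a0 => // -[b Fb].
  exists (exist _ z Fz) => a Aa; apply/asboolP => k ak /=.
  rewrite clusterE in Gz.
  have : closure [set y | e y k = e (sval a) k] z.
    by apply: Gz; exists a => // b Ab; exact.
  apply: contraPP => /eqP zk.
  have o : open [set y | 0 < `|e y k - e (sval a) k|].
    exact: corson_coball_open.
  move=> /(_ _ (open_nbhs_nbhs (conj o _)))[|t [/= -> ]] /=.
    by rewrite normr_gt0 subr_eq0.
  by rewrite subrr normr0 ltxx.
exists y; first exact: FU.
(* The constraints defining [F], relaxed to be open, together with closeness to [y] on its
   support. *)
pose Phi (kn : K * nat) : set Y := [set z |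
  (List.In kn.1 l -> `|e z kn.1 - e u kn.1| < d / 2 + kn.2.+1%:R^-1) /\
  (e y kn.1 <> 0 -> `|e z kn.1 - e y kn.1| < kn.2.+1%:R^-1)].
pose S := [set k | List.In k l] `|` [set k | e y k <> 0].
have cS : countable S.
  apply: countable_setU (se y).
  elim: l {hd F FU clF Fu cF T y Fy ymax Phi S} => [|k l IH].
    by rewrite (_ : [set k | _] = set0) //; apply/seteqP; split.
  by apply: countable_sub (countable_setU (countable1 k) IH) => j [->|jl]; [left|right].
apply: (@gdelta_countable_character Y (Phi @` (S `*` [set: nat]))) => //.
- by apply: sub_countable (card_image_le _ _) _; apply: countableX.
- move=> _ [[k n] _ <-]; rewrite /Phi /=; split; last first.
    split=> [kl|_]; last by rewrite subrr normr0 invr_gt0 ltr0n.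
    by apply: le_lt_trans (Fy k kl) _; rewrite ltrDl invr_gt0 ltr0n.
  have openI' (P : Prop) (B : set Y) : open B -> open [set z | P -> B z].
    move=> oB; have [p|np] := pselect P.
      by rewrite (_ : [set z | _] = B) //; apply/seteqP; split=> z /=; [apply|].
    rewrite (_ : [set z | _] = setT); first exact: openT.
    by apply/seteqP; split=> z //= _ /np.
  apply: openI; apply: openI'.
    exact: corson_ball_open.
  exact: corson_ball_open.
- move=> z hz.
  have Fz : F z.
    move=> k kl; apply: norm_le_invS_eq0; first by lra.
    move=> n; have /hz[] : (Phi @` (S `*` [set: nat])) (Phi (k, n)).
      by exists (k, n) => //; split=> //; left.
    by move=> /(_ kl).
  have yz : ext y z.
    move=> k yk; apply/eqP; rewrite -subr_eq0 -normr_le0; apply: norm_le_invS_eq0 => // n.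
    have /hz[] : (Phi @` (S `*` [set: nat])) (Phi (k, n)).
      by exists (k, n) => //; split=> //; right.
    by rewrite add0r => _ /(_ yk).
  have zy : ext z y.
    by apply/asboolP; apply: (ymax (exist _ z Fz)); apply/asboolP.
  apply: ie; apply: funext => k.
  have [yk|yk] := pselect (e y k = 0); last exact: yz.
  have [zk|zk] := pselect (e z k = 0); first by rewrite yk.
  by rewrite zy.
Qed.

Let box (g : nat -> option K) (q : seq (nat * (rat * rat))) : set Y := [set y |
  forall b, List.In b q -> forall k, g b.1 = Some k -> ratr b.2.1 < e y k < ratr b.2.2].

(** Inactive coordinates vanish on all of [Y], so rational boxes in the active ones suffice. There
    are countably many, and each [V m] holds at most one, which makes disjointness trivial. *)
Lemma corson_countable_pi_base : countable [set k | exists y, e y k <> 0] ->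
  exists V : nat -> set (set Y), [/\ forall m v, V m v -> open v,
    forall m v w, V m v -> V m w -> v `&` w !=set0 -> v = w &
    forall U : set Y, open U -> U !=set0 ->
      exists m v, [/\ V m v, v !=set0 & v `<=` U]].
Proof.
move=> /countable_injP[f fi].
have /choice[g hg] n : exists o : option K, forall k, (exists y, e y k <> 0) ->
    f k = n -> o = Some k.
  have [[k [ek fk]]|h] := pselect (exists k, (exists y, e y k <> 0) /\ f k = n).
    by exists (Some k) => j ej fj; congr Some; apply: fi; rewrite ?inE // fk.
  by exists None => k ek fk; case: h; exists k.
exists (fun m => [set v | exists2 q, unpickle m = Some q & v = box g q]); split.
- move=> _ v [q _ ->]; elim: q => [|b q IH].
    by rewrite (_ : box g [::] = setT); [exact: openT|apply/seteqP; split=> // y _ b []].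
  rewrite (_ : box g (b :: q) = [set y | forall k, g b.1 = Some k ->
    ratr b.2.1 < e y k < ratr b.2.2] `&` box g q); last first.
    apply/seteqP; split=> [y h|y [h1 h2] c [<-//|]]; last exact: h2.
    by split; [apply: h; left|move=> c cq; apply: h; right].
  apply: openI => //; case: (g b.1) => [k|]; last first.
    by rewrite (_ : [set y | _] = setT); [exact: openT|apply/seteqP; split].
  rewrite (_ : [set y | _] = [set y | ratr b.2.1 < e y k < ratr b.2.2]).
    under eq_set do rewrite itv_ballE.
    exact: corson_ball_open.
  by apply/seteqP; split=> y /=; [apply|move=> h j [<-]].
- by move=> m _ _ [q mq ->] [q' mq' ->] _; congr box; move: mq; rewrite mq' => -[].
- move=> U oU [u Uu]; have [l [d [d0 hd]]] := corson_open_box oU Uu.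
  have [q [qu ql]] : exists q, box g q u /\ forall k, List.In k l ->
      (exists y, e y k <> 0) -> forall y, box g q y -> `|e y k - e u k| < d.
    elim: l {hd} => [|k l [q [qu ql]]]; first by exists [::]; split=> [b []|k []].
    have [ek|nek] := pselect (exists y, e y k <> 0); last first.
      by exists q; split=> // j [<- /nek//|/ql].
    have [a] := @rat_in_itvoo R (e u k - d) (e u k) ltac:(by lra).
    have [b] := @rat_in_itvoo R (e u k) (e u k + d) ltac:(by lra).
    rewrite !in_itv /= => /andP[b1 b2] /andP[a1 a2].
    have gk := hg (f k) k ek erefl.
    exists ((f k, (a, b)) :: q); split.
      by move=> c [<-|/qu//] j /=; rewrite gk => -[<-]; rewrite a2 b1.
    move=> j [<- _|jl ej] y qy.
      have /andP[] := qy _ (or_introl erefl) k gk => /= h1 h2.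
      by rewrite ltr_norml; apply/andP; split; lra.
    by apply: ql => // c cq; apply: qy; right.
  exists (pickle q), (box g q); split; first by exists q; rewrite ?pickleK.
    by exists u.
  move=> y qy; apply: hd => k kl.
  have [ek|nek] := pselect (exists y, e y k <> 0); first exact: ql.
  have e0 z : e z k = 0 by apply: contrapT => zk; apply: nek; exists z.
  by rewrite !e0 subrr normr0.
Qed.

End CorsonCharacter.

Lemma dense_metrizable_pi_base (Y : topologicalType) (V : nat -> set (set Y)) :
  corson_compact Y -> (forall m v, V m v -> open v) ->
  (forall m v w, V m v -> V m w -> v `&` w !=set0 -> v = w) ->
  (forall U : set Y, open U -> U !=set0 -> exists m v, [/\ V m v, v !=set0 & v `<=` U]) ->
  exists D : set Y, dense D /\ metrizable_subspace D.
Proof.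
move=> [cY [hY [K [e [ce [ie [oe se]]]]]]] Vo Vd Vb.
have charY := corson_countable_character cY hY ce ie oe se.
have [[y0]|noY] := pselect (inhabited Y); last first.
  exists set0; split; first by move=> U [y]; case: noY.
  exists (fun _ _ => 0); split; first by move=> x.
  split; first by move=> x.
  split; first by move=> x.
  move=> U; split; first by move=> [W [oW ->]]; split=> [x []|x []].
  move=> [U0 _]; exists set0; split; first exact: open0.
  by rewrite set0I; apply/seteqP; split.
have /choice[pt ptP] (U : set Y) : exists x, open U -> U !=set0 ->
    U x /\ countable_character x.
  have [[oU U0]|n] := pselect (open U /\ U !=set0).
    by have [x Ux cx] := charY U oU U0; exists x.
  by exists y0 => oU U0; case: n.
have /choice[O OP] x : exists O : nat -> set Y, countable_character x ->
    [/\ forall n, open (O n) /\ O n x, forall n, O n.+1 `<=` O n &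
      forall U, open U -> U x -> exists n, O n `<=` U].
  have [[O h]|n] := pselect (countable_character x); first by exists O.
  by exists (fun=> setT).
exists [set x | exists n w, stage V pt O n (w, x)]; split.
  exact: (stage_points_dense hY Vo Vd Vb ptP OP y0).
exact: (stage_points_metrizable hY Vo Vd ptP OP y0).
Qed.

(** * Corson powers under Martin's axiom *)

Close Scope ring_scope.

Lemma MA_dense_metrizable (Y : topologicalType) : MA_aleph1_powerfully_ccc ->
  corson_compact Y -> powerfully_ccc (@open_le Y) ->
  exists D : set Y, dense D /\ metrizable_subspace D.
Proof.
move=> MA corY pcccY; have [cY [hY [K [e [ce [ie [oe se]]]]]]] := corY.
have [cact|/uncountable_aleph1[B [Bact uB aB]]] :=
  pselect (countable [set k | exists y, e y k <> 0%R]).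
  have [V [Vo Vd Vb]] := corson_countable_pi_base ce ie oe cact.
  exact: dense_metrizable_pi_base corY Vo Vd Vb.
have uI : ~ countable [set: {k | B k}].
  move=> cI; apply: uB; apply: (@countable_sub _ _ (sval @` [set: {k | B k}])).
    by move=> k Bk; exists (exist _ k Bk).
  exact: sub_countable (card_image_le _ _) cI.
have [|y uy] := @MA_uncountable_point MA Y cY hY pcccY _
  (fun i : {k | B k} => [set y | (0 < `|e y (sval i) - 0|)%R]) (card_le_aleph1_sig aB) uI.
  move=> [k Bk] /=; split; first exact: corson_coball_open.
  have [y yk] := Bact k Bk; exists y => /=.
  by rewrite subr0 normr_gt0; apply/eqP.
case: uy; apply: (@countable_preimage_inj _ _ sval _ [set k | e y k <> 0%R]) (se y).
  by move=> [i Bi] [j Bj] _ _ /= ij; exact: eq_exist.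
by move=> [i Bi] /=; rewrite subr0 normr_gt0 => /eqP.
Qed.

Lemma list_In_bound (l : seq nat) : exists n, forall i, List.In i l -> (i < n)%N.
Proof.
elim: l => [|i l [n hn]]; first by exists 0%N.
exists (maxn i.+1 n) => j [<-|/hn jn]; first by rewrite leq_max ltnSn.
by rewrite leq_max jn orbT.
Qed.

(** * Powers that are not ccc, over a base of size aleph_1 *)

Section PowerPiBase.
Variables (X : topologicalType) (B : set (set X)).
Hypotheses (bB : basis B) (aB : card_le_aleph1 B) (uB : ~ countable B).
Let Y := {ptws nat -> X}.

Lemma ptws_nat_open_box (U : set Y) (y : Y) : open U -> U y ->
  exists (n : nat) (V : nat -> set X), (forall i, open (V i) /\ V i (y i)) /\
    (forall z : Y, (forall i, (i < n)%N -> V i (z i)) -> U z).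
Proof.
move=> oU Uy; have [l [V [oV VU]]] := ptws_open_box oU Uy.
have [n ln] := list_In_bound l; exists n, V; split=> // z h.
by apply: VU => i /ln; exact: h.
Qed.

Lemma ptws_nat_box_open (n : nat) (V : nat -> set X) :
  (forall i, (i < n)%N -> open (V i)) ->
  open [set z : Y | forall i, (i < n)%N -> V i (z i)].
Proof.
elim: n => [|n IH] oV.
  by rewrite (_ : [set z | _] = setT); [exact: openT|apply/seteqP; split].
rewrite (_ : [set z | _] = (fun f : Y => f n) @^-1` (V n) `&`
    [set z : Y | forall i, (i < n)%N -> V i (z i)]).
  apply: openI; last by apply: IH => i lin; apply: oV; exact: ltnW.
  by apply: open_comp => [f _|]; [exact: ptws_proj_continuous|exact: oV].
apply/seteqP; split=> z /=.
  by move=> h; split=> [|i lin]; apply: h => //; exact: ltnW.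
by move=> [zn h] i; rewrite ltnS leq_eqVlt => /orP[/eqP->//|/h].
Qed.

Lemma card_le_aleph1_of_small (I S : Type) : card_le_aleph1 [set: I] ->
  ~ countable [set: I] -> small I S -> card_le_aleph1 [set: S].
Proof.
move=> aI uI [W [cW Ws]].
apply: (card_le_aleph1_bigcup (W := W) aI) => // l _.
have [d _ nd] := uncountable_avoid uI (Ws l).
by exists d; apply: contrapT.
Qed.

(* Multiplying the boxes by shifted copies of distinct members of an uncountable
   disjoint family separates any two boxes of the same length. *)
Lemma not_ccc_power_pi_base : ~ ccc_space Y ->
  exists V : nat -> set (set Y), [/\ forall m v, V m v -> open v,
    forall m v w, V m v -> V m w -> v `&` w !=set0 -> v = w &
    forall U : set Y, open U -> U !=set0 ->
      exists m v, [/\ V m v, v !=set0 & v `<=` U]].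
Proof.
move=> /existsNP[F /not_implyP[oF /not_implyP[dF uF]]].
have /choice[y hy] (U : set Y) : exists y, F U -> U y.
  have [FU|nF] := pselect (F U); first by have [_ [y Uy]] := oF U FU; exists y.
  have [U0 FU0 _] := uncountable_avoid uF (countable0 _).
  by have [_ [y _]] := oF U0 FU0; exists y.
have /choice[n] (U : set Y) : exists (n : nat), exists V : nat -> set X, F U ->
    (forall i, open (V i) /\ V i (y U i)) /\
    (forall z : Y, (forall i, (i < n)%N -> V i (z i)) -> U z).
  have [FU|nF] := pselect (F U); last by exists 0%N, (fun=> setT).
  have [n [V h]] := ptws_nat_open_box (oF U FU).1 (hy U FU).
  by exists n, V.
move=> /choice[W hW].
(* A common length [N] puts the added factors of boxes with equal [size b] on the same [N]
   coordinates. *)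
have [N uF'] := uncountable_type n uF.
have uI : ~ countable [set: {U | B U}].
  move=> cI; apply: uB; apply: (@countable_sub _ _ (sval @` [set: {U | B U}])).
    by move=> k Bk; exists (exist _ k Bk).
  exact: sub_countable (card_image_le _ _) cI.
have aI := card_le_aleph1_sig aB.
have [u [ui Fu]] := card_le_aleph1_inj
  (card_le_aleph1_of_small aI uI (small_seq (card_le_aleph1_small aI))) uF'.
pose side (b : seq {U | B U}) i : set X := nth setT [seq sval U | U <- b] i.
pose fac b i : set X := if (i < size b)%N then side b i else W (u b) (i - size b)%N.
pose v b : set Y := [set z | forall i, (i < size b + N)%N -> fac b i (z i)].
have vE b z : v b z <-> (forall i, (i < size b)%N -> side b i (z i)) /\
    (forall i, (i < N)%N -> W (u b) i (z (size b + i)%N)).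
  split=> [h|[h1 h2] i hi].
    split=> i hi; first by have := h i (ltn_addr _ hi); rewrite /fac hi.
    have := h (size b + i)%N; rewrite ltn_add2l => /(_ hi); rewrite /fac.
    by rewrite ltnNge leq_addr addKn.
  rewrite /fac; have [lt|le] := ltnP i (size b); first exact: h1.
  by have := h2 (i - size b)%N; rewrite subnKC // ltn_subLR //; apply.
have oside b i : (i < size b)%N -> open (side b i).
  move=> ib; rewrite /side (nth_map (tnth (in_tuple b) (Ordinal ib))) //.
  by apply: bB.1; case: (nth _ _ _).
exists (fun m => [set t | exists2 b, size b = m & t = v b]); split.
- move=> _ _ [b _ ->]; apply: (@ptws_nat_box_open _ (fac b)) => i _.
  rewrite /fac; case: ltnP => [ib|_]; first exact: oside.
  by have [/hW[/(_ (i - size b)%N)[]]] := Fu b.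
- move=> _ _ _ [b <- ->] [c sc ->] [z [/vE[_ bz] /vE[_ cz]]].
  suff -> : b = c by [].
  apply: ui; apply: contrapT => ne.
  have [Fb nb] := Fu b; have [Fc nc] := Fu c.
  have : (u b `&` u c) (fun i => z (size b + i)%N).
    split; first by have [_] := hW _ Fb; apply; rewrite nb.
    by have [_] := hW _ Fc; apply; rewrite nc -sc.
  by rewrite dF.
- move=> U oU [x Ux]; have [m [V [oV VU]]] := ptws_nat_open_box oU Ux.
  have /choice[s hs] i : exists S : {S | B S}, sval S (x i) /\ sval S `<=` V i.
    have [oVi Vx] := oV i; have [S [BS Sx] SV] := bB.2 (x i) _ (open_nbhs_nbhs (conj oVi Vx)).
    by exists (exist _ S BS).
  pose b := mkseq s m.
  have sb : size b = m by rewrite size_mkseq.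
  have sideE i : (i < m)%N -> side b i = sval (s i).
    by move=> im; rewrite /side (nth_map (s 0%N)) ?sb // nth_mkseq.
  exists m, (v b); split; first by exists b.
    exists (fun i => if (i < m)%N then x i else y (u b) (i - m)%N); apply/vE; rewrite sb.
    split=> i im; first by rewrite im sideE //; exact: (hs i).1.
    rewrite ltnNge leq_addr addKn.
    by have [/hW[/(_ i)[]]] := Fu b.
  move=> z /vE[h _]; apply: VU => i im; apply: (hs i).2.
  by rewrite -sideE //; apply: h; rewrite sb.
Qed.

End PowerPiBase.

(** * Combinatorial form of the failure of Martin's axiom *)

Lemma rasiowa_sikorski (P : Type) (le : P -> P -> Prop) (p0 : P) (Ds : set (set P)) :
  (forall p, le p p) -> (forall p q r, le p q -> le q r -> le p r) ->
  countable Ds -> (forall D, Ds D -> dense_in le D) ->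
  exists G : set P, poset_filter le G /\ forall D, Ds D -> G `&` D !=set0.
Proof.
move=> le_refl le_trans /countable_injP[f fi] dense.
have /choice[g hg] (np : nat * P) : exists q, le q np.2 /\
    forall D, Ds D -> f D = np.1 -> D q.
  have [[D [DsD fD]]|h] := pselect (exists D, Ds D /\ f D = np.1).
    have [q Dq qp] := dense D DsD np.2; exists q; split=> // D' DsD' fD'.
    suff -> : D' = D by [].
    by apply: fi; rewrite ?inE // fD.
  by exists np.2; split=> // D DsD fD; case: h; exists D.
pose s := fix s n := if n is n'.+1 then g (n', s n') else p0.
have s_le m n : m <= n -> le (s n) (s m).
  elim: n => [|n IH]; first by rewrite leqn0 => /eqP->.
  rewrite leq_eqVlt => /orP[/eqP->//|/IH].
  by apply: le_trans; have [] := hg (n, s n).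
exists [set p | exists n, le (s n) p]; split; last first.
  move=> D DsD; exists (s (f D).+1); split; first by exists (f D).+1.
  by have [_] := hg (f D, s (f D)); apply.
split; first by exists p0, 0.
split; first by move=> p q [n sp] pq; exists n; exact: le_trans pq.
move=> p q [m sp] [n sq]; exists (s (maxn m n)); first by exists (maxn m n).
by split; [apply: le_trans sp|apply: le_trans sq]; apply: s_le;
  rewrite (leq_maxl, leq_maxr).
Qed.

Lemma uncountable_cantor : ~ countable [set: nat -> bool].
Proof.
move=> /countable_injP[f fi].
pose x n := `[< forall y, f y = n -> ~~ y n >].
have xx : x (f x) = ~~ x (f x).
  apply/idP/idP; first by move=> /asboolP; apply.
  move=> nx; apply/asboolP => y fy.
  by rewrite (fi y x) ?inE.
by case: (x (f x)) xx.
Qed.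

(** The index set is the family [Ds] of dense sets itself: uncountable by [rasiowa_sikorski], and
    injected into the reals because the Cantor set is uncountable. If no [K] over it were as
    required, [precaliber_generic] would give the forbidden filter. *)
Lemma not_MA_family : ~ MA_aleph1_powerfully_ccc ->
  exists (I : choiceType) (r : I -> nat -> bool) (K : seq I -> Prop),
  [/\ injective r, card_le_aleph1 [set: I] & ~ countable [set: I]] /\
  [/\ hereditary K, forall i, K [:: i], pccc_family K &
    forall Z, homogeneous K Z -> countable Z].
Proof.
move=> /existsNP[P] /existsNP[le] /not_implyP[[p0]] /not_implyP[po] /not_implyP[pccc].
move=> /existsNP[Ds] /not_implyP[aDs] /not_implyP[dDs noG].
have uDs : ~ countable Ds.
  move=> cDs; apply: noG; have [le_refl [_ le_trans]] := po.
  exact: rasiowa_sikorski cDs dDs.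
pose I : choiceType := {classic {D | Ds D}}.
have aI : card_le_aleph1 [set: I] by exact: card_le_aleph1_sig.
have uI : ~ countable [set: I].
  move=> cI; apply: uDs; apply: (@countable_sub _ _ (sval @` [set: I])).
    by move=> D DsD; exists (exist _ D DsD).
  exact: sub_countable (card_image_le _ _) cI.
have [r [ri _]] := card_le_aleph1_inj aI uncountable_cantor.
apply: contrapT => noK.
have PC : precaliber_families I.
  move=> K hK K1 pK; apply: contrapT => noZ; apply: noK; exists I, r, K; split=> //.
  by split=> // Z hZ; apply: contrapT => uZ; apply: noZ; exists Z.
have [|G [fG GD]] := precaliber_generic PC (card_le_aleph1_small aI) ri p0
  (D := fun i : I => sval (i : {D | Ds D})) po pccc.
  by move=> [D DsD]; exact: dDs.
apply: noG; exists G; split=> // D DsD.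
exact: (GD (exist _ D DsD : I)).
Qed.

(** * The space of homogeneous sets *)

Lemma ccc_open_poset (Y : topologicalType) : ccc_space Y -> ccc_poset (@open_le Y).
Proof.
move=> cccY A antiA.
apply: (@countable_preimage_inj _ _ sval A (sval @` A)).
- by move=> [U hU] [V hV] _ _ /= e; exact: eq_exist.
- by move=> U AU; exists U.
apply: cccY => [_ [U _ <-]|_ _ [U AU <-] [V AV <-] UV]; first exact: (svalP U).
apply: contrapT => /eqP/set0P UV0; apply: (antiA U V AU AV).
  by move=> e; apply: UV; rewrite e.
have oUV : open (sval U `&` sval V) by apply: openI; [case: (svalP U)|case: (svalP V)].
by exists (NonemptyOpen (conj oUV UV0)); split=> x [].
Qed.

(** For each [n], take a countable maximal antichain of open sets whose traces on [D] lie in balls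
    of radius the inverse of [n.+1]; the centres for all [n] form the dense set. *)
Lemma ccc_dense_metrizable_separable (Y : topologicalType) (D : set Y) :
  ccc_space Y -> dense D -> metrizable_subspace D ->
  exists S : set Y, countable S /\ dense S.
Proof.
move=> cccY dD [d [d0 [dsym [dtri dopen]]]].
have dge0 x y : D x -> D y -> (0 <= d x y)%R.
  move=> Dx Dy; have := dtri x y x Dx Dy Dx.
  by rewrite (dsym y x) // (proj2 (d0 x x Dx Dx)) // => ?; lra.
have dxx x : D x -> d x x = 0%R by move=> Dx; apply/(d0 x x Dx Dx).
have ball_open (x : Y) (n : nat) : exists V : set Y, D x -> [/\ open V, V x &
    forall y, D y -> V y -> (d x y < n.+1%:R^-1)%R].
  have [Dx|nD] := pselect (D x); last by exists setT.
  have [_ /(_ _)[|V [oV eV]]] := dopen [set y | D y /\ (d x y < n.+1%:R^-1)%R].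
    split=> [y []//|y [Dy xy]]; exists (n.+1%:R^-1 - d x y)%R; first by rewrite subr_gt0.
    move=> z [Dz yz]; split=> //; apply: le_lt_trans (dtri x y z Dx Dy Dz) _.
    by rewrite -ltrBrDl.
  have Vx : (D `&` V) x by rewrite -eV; split=> //; rewrite dxx // invr_gt0 ltr0n.
  exists V => _; split=> //; first by case: Vx.
  by move=> y Dy Vy; have : (D `&` V) y by []; rewrite -eV => -[].
have [[y0 Dy0]|D0] := pselect (D !=set0); last first.
  exists set0; split=> // U U0 /(dD U U0)[y [_ Dy]].
  by case: D0; exists y.
have /choice[V hV] xn := ball_open xn.1 xn.2.
pose B n : set (nonempty_open Y) := [set W | exists2 x, D x & sval W = V (x, n)].
have /choice[A hA] n := ccc_predense_countable (B n)
  (proj1 (open_le_partial_order Y)) (ccc_open_poset cccY).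
have /choice[c hc] (Wn : nonempty_open Y * nat) : exists x, B Wn.2 Wn.1 ->
    D x /\ sval Wn.1 = V (x, Wn.2).
  have [[x Dx WV]|nB] := pselect (B Wn.2 Wn.1); first by exists x.
  by exists y0.
exists (\bigcup_(n in [set: nat]) ((fun W => c (W, n)) @` A n)); split.
  apply: bigcup_countable => // n _; have [_ cA _] := hA n.
  exact: sub_countable (card_image_le _ _) cA.
move=> U U0 oU; have [y [Uy Dy]] := dD U U0 oU.
have [|_ /(_ y)[|e e0 he]] := proj1 (dopen (D `&` U)); [by exists U|by []|].
(* Half of [e], because the distance from [y] to a centre is estimated through a point [z] of [D]
   common to both neighbourhoods. *)
have [n hn] := @archi_invS (e / 2)%R (ltac:(by apply: divr_gt0; rewrite ?ltr0n)).
have [oV Vy Vyd] := hV (y, n) Dy.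
have [AB _ Apre] := hA n.
have [|W AW [Z [ZW ZV]]] := Apre (NonemptyOpen (conj oV (ex_intro _ y Vy))).
  by exists y.
have [Dc WV] := hc (W, n) (AB W AW).
have [oZ Z0] := svalP Z; have [z [Zz Dz]] := dD _ Z0 oZ.
have [_ _ Vcd] := hV (c (W, n), n) Dc.
have zc : (d (c (W, n)) z < n.+1%:R^-1)%R by apply: Vcd => //; rewrite -WV; exact: ZW.
have zy : (d y z < n.+1%:R^-1)%R by apply: Vyd => //; exact: ZV.
exists (c (W, n)); split; last by exists n => //; exists W.
have [] // : (D `&` U) (c (W, n)).
apply: he; split=> //.
apply: le_lt_trans (dtri y z _ Dy Dz Dc) _; rewrite (dsym z) //.
move: zc zy hn; move: (n.+1%:R^-1)%R => t ? ? ?; lra.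
Qed.

Lemma ccc_space_of_ptws_nat (X : topologicalType) : ccc_space {ptws nat -> X} -> ccc_space X.
Proof.
move=> cccY F oF dF.
pose lift (U : set X) : set {ptws nat -> X} := [set y | U (y 0%N)].
apply: (@countable_preimage_inj _ _ lift F (lift @` F)).
- move=> U V _ _ e; apply/seteqP; split=> x hx.
    have : lift V (fun=> x) by rewrite -e.
    by [].
  have : lift U (fun=> x) by rewrite e.
  by [].
- by move=> U FU; exists U.
apply: cccY => [_ [U FU <-]|_ _ [U FU <-] [V FV <-] UV].
  have [oU [x Ux]] := oF U FU; split; last by exists (fun=> x).
  apply: (@open_comp _ _ (fun f : {ptws nat -> X} => f 0%N)) => // f _.
  exact: ptws_proj_continuous.
apply/seteqP; split=> // y [Uy Vy].
have : (U `&` V) (y 0%N) by [].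
by rewrite dF // => e; apply: UV; rewrite e.
Qed.

(** Localise to a condition [a0] below which every condition is compatible with uncountably many
    singletons. Some singletons may be lost, hence [K' [::]]; gained are extensions outside any
    countable set, the source of non-separability. *)
Lemma frequent_subfamily (I : choiceType) (K : seq I -> Prop) :
  ~ countable [set: I] -> hereditary K -> (forall i, K [:: i]) -> pccc_family K ->
  (forall Z, homogeneous K Z -> countable Z) ->
  exists K' : seq I -> Prop, [/\ hereditary K', K' [::], pccc_family K',
    forall Z, homogeneous K' Z -> countable Z &
    forall a C, K' a -> countable C -> exists2 i, ~ C i & K' (i :: a)].
Proof.
move=> uI hK K1 pK Kc.
pose P := {a | K a}.
pose le (x y : P) : Prop := {subset sval y <= sval x}.
have le_refl x : le x x by [].
have le_trans x y z : le x y -> le y z -> le x z by move=> xy yz i /yz/xy.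
have catl (a b c : seq I) : {subset a <= c} -> {subset b <= c} -> {subset a ++ b <= c}.
  by move=> ac bc i; rewrite mem_cat => /orP[/ac|/bc].
have ccc : ccc_poset le.
  move=> A antiA; apply: contrapT => uA.
  have [||f [g [[x Ax <-] [y Ay <-] fg /(_ ord0) Kxy]]] :=
    pK 1 ((fun (x : P) (_ : 'I_1) => sval x) @` A).
  - move=> cA; apply: uA.
    apply: (@countable_preimage_inj _ _ (fun (x : P) (_ : 'I_1) => sval x) _ _ _ _ cA) => [x y _ _|x Ax].
      move=> /(congr1 (fun f => f ord0)) /=.
      by case: x y => [x Kx] [y Ky] /= exy; exact: eq_exist.
    by exists x.
  - by move=> _ [x _ <-] _; exact: svalP.
  apply: (antiA x y Ax Ay); first by move=> e; apply: fg; rewrite e.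
  by exists (exist _ _ Kxy); split=> i /= ia; rewrite mem_cat ia ?orbT.
have [[a0 Ka0] ha0] := ccc_frequent_below (fun i => exist _ [:: i] (K1 i) : P)
  le_refl le_trans ccc uI.
exists (fun a => K (a0 ++ a)); split.
- move=> a b ab; apply: hK; apply: catl => i ia; rewrite mem_cat ?ia //.
  by rewrite ab ?orbT.
- by apply: (hK _ _ _ Ka0) => i; rewrite cats0.
- move=> N G uG GK.
  have [||f [g [[f' Gf <-] [g' Gg <-] fg Kfg]]] :=
    pK N ((fun (f : 'I_N -> seq I) j => a0 ++ f j) @` G).
  + move=> cG; apply: uG.
    apply: (@countable_preimage_inj _ _ (fun f j => a0 ++ f j) _ _ _ _ cG) => [f g _ _ e|f Gf].
      apply: funext => j; have /= := congr1 (fun h => h j) e.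
      by move=> /(congr1 (drop (size a0))); rewrite !drop_size_cat.
    by exists f.
  + by move=> _ [f Gf <-] j; exact: GK.
  exists f', g'; split=> //; first by move=> e; apply: fg; rewrite e.
  move=> j; apply: hK (Kfg j) => i; rewrite !mem_cat.
  by case: (i \in a0) => //=; case: (i \in f' j).
- move=> Z hZ; apply: Kc => a aZ; apply: hK (hZ a aZ) => i ia.
  by rewrite mem_cat ia orbT.
- move=> a C Ka cC.
  have [|i nCi [[b Kb] [/= ba bi]]] := ha0 (exist _ _ Ka) _ C cC.
    by move=> i /= ia; rewrite mem_cat ia.
  exists i => //; apply: (hK _ _ _ Kb); apply: catl.
    by move=> j ja; apply: ba; rewrite /= mem_cat ja.
  move=> j; rewrite inE => /orP[/eqP->|ja]; first by apply: bi; rewrite inE.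
  by apply: ba; rewrite /= mem_cat ja orbT.
Qed.

Section HomogeneousSpace.
Variables (I : choiceType) (K : seq I -> Prop).
Hypotheses (hK : hereditary K) (K0 : K [::]).

Definition homogeneous_sets : set {ptws I -> bool} :=
  [set x | forall a : seq I, (forall i, i \in a -> x i) -> K a].

Definition homogeneous_space : topologicalType := set_type homogeneous_sets.
Local Notation X := homogeneous_space.

Definition chi (x : X) : I -> bool := set_val x.

Lemma chi_inj : injective chi.
Proof. by move=> x y e; exact: val_inj. Qed.

Lemma chi_homogeneous (x : X) (a : seq I) : (forall i, i \in a -> chi x i) -> K a.
Proof. by have := set_valP x; apply. Qed.

Definition box (a b : seq I) : set X :=
  [set x | (forall i, i \in a -> chi x i) /\ (forall i, i \in b -> ~~ chi x i)].

Lemma finite_point_proof (a : seq I) : exists x : X, K a -> chi x = mem a.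
Proof.
have [Ka|nKa] := pselect (K a).
  have h : homogeneous_sets (fun i => i \in a) by move=> b ba; apply: hK Ka.
  by exists (SigSub (mem_set h)).
have h : homogeneous_sets (fun=> false) by move=> [|i b] // /(_ i (mem_head _ _)).
by exists (SigSub (mem_set h)).
Qed.

Definition finite_point (a : seq I) : X := sval (cid (finite_point_proof a)).

Lemma chi_finite_point (a : seq I) (i : I) : K a -> chi (finite_point a) i = (i \in a).
Proof. by move=> Ka; rewrite /finite_point; case: cid => x /= ->. Qed.

Lemma finite_point_box (a b c : seq I) : K c -> {subset a <= c} ->
  (forall i, i \in b -> i \notin c) -> box a b (finite_point c).
Proof.
move=> Kc ac bc; split=> i hi; rewrite chi_finite_point //; first exact: ac.
exact: bc.
Qed.

Lemma chi_open (W : set bool) (i : I) : open [set x : X | W (chi x i)].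
Proof.
exists [set f : {ptws I -> bool} | W (f i)] => //.
apply: (@open_comp _ _ (fun f : {ptws I -> bool} => f i)) => [f _|].
  exact: ptws_proj_continuous.
exact: discrete_open.
Qed.

Lemma box_open (a b : seq I) : open (box a b).
Proof.
have all_open (W : set bool) (l : seq I) : open [set x : X | forall i, i \in l -> W (chi x i)].
  elim: l => [|i l IH].
    by rewrite (_ : [set x | _] = setT); [exact: openT|apply/seteqP; split].
  rewrite (_ : [set x | _] = [set x : X | W (chi x i)] `&`
     [set x : X | forall i, i \in l -> W (chi x i)]).
    by apply: openI; [exact: chi_open|exact: IH].
  apply/seteqP; split=> x /=.
    by move=> h; split=> [|j jl]; apply: h; rewrite inE ?eqxx // jl orbT.
  by move=> [xi xl] j; rewrite inE => /orP[/eqP->//|/xl].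
have := openI (all_open [set c | c] a) (all_open [set c | ~~ c] b).
by [].
Qed.

Lemma open_box (U : set X) (x : X) : open U -> U x ->
  exists a b, box a b x /\ box a b `<=` U.
Proof.
move=> [A oA <-] Ax; have [l [V [oV VA]]] := ptws_open_box oA Ax.
have lP i : List.In i l -> i \in l.
  by elim: l {VA} => //= j l IH [->|/IH il]; rewrite inE ?eqxx // il orbT.
exists [seq i <- l | chi x i], [seq i <- l | ~~ chi x i]; split.
  by split=> i; rewrite mem_filter => /andP[].
move=> y [h1 h2]; apply: VA => i il.
have -> : set_val y i = set_val x i; last by have [] := oV i.
have [xi|xi] := boolP (chi x i); rewrite -/(chi x i) -/(chi y i).
  by rewrite xi; apply: h1; rewrite mem_filter xi lP.
by rewrite (negbTE xi); apply/negbTE/h2; rewrite mem_filter xi lP.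
Qed.

Lemma homogeneous_compact : compact [set: X].
Proof.
move=> F FF _.
have [z [_ Fz]] := @ptws_compact I bool bool_compact ((set_val : X -> _) @ F) _ filterT.
(* Any finite part of the cluster point [z] is contained in some point of the space, so it lies in
   [K]. *)
have hz : homogeneous_sets z.
  move=> a az.
  pose l := a; have [_ [[x _ <-] h]] : (range (set_val : X -> {ptws I -> bool}) `&`
      [set f | forall i, List.In i l -> [set true] (f i)]) !=set0.
    apply: Fz.
      by apply: (@filterS X F _ setT) => [x _|]; [exists x|exact: filterT].
    apply: open_nbhs_nbhs; split; last first.
      move=> i il /=; apply: az; rewrite -/l.
      by elim: l il => //= j l IH [->|/IH il]; rewrite inE ?eqxx // il orbT.
    by apply: (@ptws_box_open I bool l (fun=> [set true])) => i; exact: discrete_open.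
  apply: (@chi_homogeneous x) => i ia; apply: h; rewrite /l.
  by elim: (a) ia => //= j m IH; rewrite inE => /orP[/eqP->|/IH]; [left|right].
exists (SigSub (mem_set hz)); split=> // A B FA.
move=> /nbhs_open_sub[_ [[C oC <-] Cz CB]].
have [f [[x Ax <-] Cx]] : ((set_val : X -> _) @` A) `&` C !=set0.
  apply: Fz; last by apply: open_nbhs_nbhs; split.
  by apply: (@filterS X F _ A) => // x Ax; exists x.
by exists x; split=> //; apply: CB.
Qed.

Lemma homogeneous_corson : (forall Z, homogeneous K Z -> countable Z) -> corson_compact X.
Proof.
move=> Kc.
pose e (x : X) : {ptws I -> R} := fun i => if chi x i then 1%R else 0%R.
apply: (@corson_of_injection _ _ e) => //.
- exact: homogeneous_compact.
- apply: ptws_continuous => i; apply/continuousP => W oW.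
  exact: (@chi_open [set c | W (if c then 1%R else 0%R)] i).
- move=> x y xy; apply: chi_inj; apply: funext => i.
  have := congr1 (fun f : {ptws I -> R} => f i) xy; rewrite /e.
  by case: (chi x i) (chi y i) => -[] // /eqP; rewrite ?oner_eq0 // eq_sym oner_eq0.
- move=> x; apply: (@countable_sub _ _ [set i | chi x i]).
    by move=> i; rewrite /e /=; case: (chi x i).
  by apply: Kc => a ha; apply: (@chi_homogeneous x).
Qed.

Local Notation Y := {ptws nat -> X}.

Lemma ptws_open_boxes (U : set Y) (y : Y) : open U -> U y ->
  exists (N : nat) (a b : nat -> seq I), (forall j, box (a j) (b j) (y j)) /\
    forall z : Y, (forall j, (j < N)%N -> box (a j) (b j) (z j)) -> U z.
Proof.
move=> oU Uy; have [N [V [oV VU]]] := ptws_nat_open_box oU Uy.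
have /choice[a /choice[b hab]] j : exists a b, box a b (y j) /\ box a b `<=` V j.
  by have [oVj Vy] := oV j; exact: open_box.
exists N, a, b; split=> [j|z hz]; first by have [] := hab j.
by apply: VU => j /hz; have [_] := hab j; apply.
Qed.

Lemma box_disjoint (a b : seq I) (x : X) (i : I) : box a b x -> i \in b -> i \notin a.
Proof. by move=> [h1 h2] /h2; apply: contraNN; exact: h1. Qed.

Lemma box_nonempty_K (a b : seq I) (x : X) : box a b x -> K a.
Proof. by move=> [h1 _]; exact: (@chi_homogeneous x). Qed.

Lemma code_separating (r : I -> nat -> bool) (l : seq I) : injective r ->
  exists m, forall i j, i \in l -> j \in l -> mkseq (r i) m = mkseq (r j) m -> i = j.
Proof.
move=> ri; elim: l => [|k l [m hm]]; first by exists 0%N.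
have mono i j m1 m2 : (m1 <= m2)%N -> mkseq (r i) m2 = mkseq (r j) m2 ->
    mkseq (r i) m1 = mkseq (r j) m1.
  move=> le e; have te x : take m1 (mkseq x m2) = mkseq x m1 :> seq bool.
    by rewrite /mkseq -map_take take_iota (minn_idPl le).
  by rewrite -!te e.
have [m' hm'] : exists m', forall j, j \in l -> mkseq (r k) m' = mkseq (r j) m' -> k = j.
  elim: l {hm} => [|j l [p hp]]; first by exists 0%N.
  have [kj|kj] := pselect (k = j).
    by exists p => t; rewrite inE => /orP[/eqP->//|tl]; exact: hp.
  have [n rn] : exists n, r k n <> r j n.
    by apply: contrapT => h; apply: kj; apply: ri; apply: funext => n;
      apply: contrapT => rn; apply: h; exists n.
  exists (maxn p n.+1) => t; rewrite inE => /orP[/eqP->|tl] e.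
    case: rn; have := mono _ _ n.+1 _ (leq_maxr _ _) e.
    by move=> /(congr1 (fun s => nth false s n)); rewrite !nth_mkseq.
  by apply: hp => //; exact: mono (leq_maxl _ _) e.
exists (maxn m m') => i j; rewrite !inE => /orP[/eqP->|il] /orP[/eqP->|jl] e //.
- by apply: hm' => //; exact: mono (leq_maxr _ _) e.
- by apply/esym; apply: hm' => //; exact: mono (leq_maxr _ _) (esym e).
- by apply: hm => //; exact: mono (leq_maxl _ _) e.
Qed.

(* Two boxes with the same type [(r i restricted to m)] have [a] disjoint from [b'],
   so only the positive parts can obstruct a common point. *)
Lemma homogeneous_power_ccc (r : I -> nat -> bool) : injective r -> pccc_family K ->
  ccc_space Y.
Proof.
move=> ri pK F oF dF; apply: contrapT => uF.
have /choice[N] (U : set Y) : exists N : nat, exists ab : (nat -> seq I) * (nat -> seq I),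
    exists y : Y, F U -> (forall j, box (ab.1 j) (ab.2 j) (y j)) /\
      forall z : Y, (forall j, (j < N)%N -> box (ab.1 j) (ab.2 j) (z j)) -> U z.
  have [FU|nF] := pselect (F U); last by exists 0%N, (fun=> [::], fun=> [::]), (fun=> finite_point [::]).
  have [oU [y Uy]] := oF U FU; have [N [a [b h]]] := ptws_open_boxes oU Uy.
  by exists N, (a, b), y.
move=> /choice[ab /choice[y hF]].
pose a U := (ab U).1; pose b U := (ab U).2.
have /choice[m hm] U := code_separating
  (flatten [seq a U j ++ b U j | j <- iota 0 (N U)]) ri.
pose code U (l : seq I) := [seq mkseq (r i) (m U) | i <- l].
pose tau U := (N U, m U, [seq (code U (a U j), code U (b U j)) | j <- iota 0 (N U)]).
have [t ut] := uncountable_type tau uF.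
(* Equal types give some [k] in [b U j] with the same code as [i]; the length [m U] separates the
   indices of the box of [U], so [i = k], against the disjointness of [a U j] and [b U j]. *)
have sep U V j i : F U /\ tau U = t -> F V /\ tau V = t -> (j < N U)%N ->
    i \in a U j -> i \in b V j -> False.
  move=> [FU <-] [FV /esym tUV] jN ia ib.
  have [eN em ec] : [/\ N U = N V, m U = m V &
    [seq (code U (a U j), code U (b U j)) | j <- iota 0 (N U)] =
    [seq (code V (a V j), code V (b V j)) | j <- iota 0 (N V)]] by case: tUV.
  have : code U (b U j) = code V (b V j).
    move: ec => /(congr1 (fun s => (nth ([::], [::]) s j).2)).
    by rewrite !(nth_map 0%N) ?size_iota -?eN // !nth_iota // -?eN.
  rewrite {2}/code -em => eb.
  have : mkseq (r i) (m U) \in code U (b U j) by rewrite eb; exact: map_f.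
  move=> /mapP[k kb ik].
  have ins l : (l \in a U j ++ b U j) -> l \in flatten [seq a U j ++ b U j | j <- iota 0 (N U)].
    move=> h; apply/flattenP; exists (a U j ++ b U j) => //.
    by apply/mapP; exists j; rewrite // mem_iota.
  have eik : i = k by apply: (hm U) ik; apply: ins; rewrite mem_cat ?ia ?kb ?orbT.
  have [ybox _] := hF U FU.
  by have := box_disjoint (ybox j) kb; rewrite -eik ia.
suff [U [V [[FU tU] [FV tV] UV KUV]]] : exists U V, [/\ F U /\ tau U = t,
    F V /\ tau V = t, U <> V & forall j, (j < N U)%N -> K (a U j ++ a V j)].
  have eN : N U = N V by have := tU; rewrite -tV => -[].
  pose z : Y := fun j => finite_point (if (j < N U)%N then a U j ++ a V j else [::]).
  have : (U `&` V) z.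
    split.
      have [ybox] := hF U FU; apply=> j jN; rewrite /z jN; apply: finite_point_box.
      - exact: KUV.
      - by move=> i; rewrite mem_cat => ->.
      - move=> i ib; rewrite mem_cat negb_or (box_disjoint (ybox j) ib) /=.
        by apply/negP => ia; apply: (@sep V U j i); rewrite -?eN.
    have [ybox] := hF V FV; apply=> j; rewrite -eN => jN; rewrite /z jN; apply: finite_point_box.
    - exact: KUV.
    - by move=> i ia; rewrite mem_cat ia orbT.
    - move=> i ib; rewrite mem_cat negb_or (box_disjoint (ybox j) ib) andbT.
      by apply/negP => ia; apply: (@sep U V j i).
  by rewrite dF.
pose A (U : set Y) : 'I_t.1.1 -> seq I := fun j => a U j.
(* Equal positive parts are compatible at once; otherwise [A] is injective and [pK] applies to its
   uncountable image. *)
have [[U [V [hU hV UV AUV]]]|inj] := pselect (exists U V, [/\ F U /\ tau U = t,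
    F V /\ tau V = t, U <> V & A U = A V]).
  exists U, V; split=> // j; have := hU.2 => /(congr1 (fun s => s.1.1)) /= -> jN.
  have := congr1 (fun f => f (Ordinal jN)) AUV; rewrite /A /= => <-.
  have [/(_ j)/box_nonempty_K Ka _] := hF U hU.1.
  by apply: hK Ka => i; rewrite mem_cat orbb.
have [||_ [_ [[U hU <-] [V hV <-] UV KUV]]] :=
  pK _ (A @` [set U | F U /\ tau U = t]).
- move=> cA; apply: ut; apply: (@countable_preimage_inj _ _ A _ _ _ _ cA) => [U V hU hV e|U hU].
    by apply: contrapT => ne; apply: inj; exists U, V.
  by exists U.
- move=> _ [U [FU _] <-] j; have [/(_ j)/box_nonempty_K Ka _] := hF U FU.
  exact: Ka.
exists U, V; split=> //; first by move=> e; apply: UV; rewrite e.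
move=> j; have := hU.2 => /(congr1 (fun s => s.1.1)) /= -> jN.
exact: (KUV (Ordinal jN)).
Qed.

Hypothesis Kc : forall Z, homogeneous K Z -> countable Z.
Hypothesis Kext : forall a C, K a -> countable C -> exists2 i, ~ C i & K (i :: a).

Lemma countable_support (x : X) : countable [set i | chi x i].
Proof. by apply: Kc => a ha; apply: (@chi_homogeneous x). Qed.

Lemma homogeneous_power_not_separable (S : set Y) : countable S -> ~ dense S.
Proof.
move=> cS dS.
have cC : countable (\bigcup_(y in S) [set i | chi (y 0%N) i]).
  by apply: bigcup_countable => // y _; exact: countable_support.
have [i ni Ki] := Kext K0 cC.
have [||y [yi Sy]] := dS [set y : Y | box [:: i] [::] (y 0%N)].
- exists (fun=> finite_point [:: i]); exact: finite_point_box.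
- apply: (@open_comp _ _ (fun f : Y => f 0%N)) => [f _|]; last exact: box_open.
  exact: ptws_proj_continuous.
by apply: ni; exists y => //; apply: yi.1; rewrite inE.
Qed.

Lemma homogeneous_not_second_countable : ~ @second_countable X.
Proof.
move=> [B cB [oB bB]].
have /choice[p hp] (U : set X) : exists x, U !=set0 -> U x.
  have [[x Ux]|n] := pselect (U !=set0); first by exists x.
  by exists (finite_point [::]).
have cC : countable (\bigcup_(U in B) [set i | chi (p U) i]).
  by apply: bigcup_countable => // U _; exact: countable_support.
have [i ni Ki] := Kext K0 cC.
have Bi : box [:: i] [::] (finite_point [:: i]) by exact: finite_point_box.
have [U [BU Ui] /= Usub] := bB _ _ (open_nbhs_nbhs (conj (box_open _ _) Bi)).
have /Usub[pi _] : U (p U) by apply: hp; exists (finite_point [:: i]).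
by apply: ni; exists U => //; apply: pi; rewrite inE.
Qed.

Lemma homogeneous_weight : card_le_aleph1 [set: I] -> ~ countable [set: I] ->
  weight_aleph1 X.
Proof.
move=> aI uI; split; last exact: homogeneous_not_second_countable.
exists ((fun ab => box ab.1 ab.2) @` [set: seq I * seq I]); split.
  have sI := small_seq (card_le_aleph1_small aI).
  exact: card_le_aleph1_image (card_le_aleph1_of_small aI uI (small_prod sI sI)).
split; first by move=> _ [[a b] _ <-]; exact: box_open.
move=> x A /nbhs_open_sub[U [oU Ux UA]]; have [a [b [abx abU]]] := open_box oU Ux.
exists (box a b); last exact: subset_trans UA.
by split=> //; exists (a, b).
Qed.

(** A box restricts the first coordinate by finitely many indices, so one of its points can receive
    an index outside [C], and then a neighbourhood of it misses the set. Taking for [C] the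
    countable sets [W d] gives a cover of the power. *)
Lemma homogeneous_power_nowhere_dense (C : set I) : countable C ->
  nowhere_dense [set y : Y | forall i, chi (y 0%N) i -> C i].
Proof.
move=> cC; apply/seteqP; split=> // y /nbhs_open_sub[U [oU Uy UC]].
have [N [a [b [ybox hU]]]] := ptws_open_boxes oU Uy.
have cCb : countable (C `|` [set i | i \in b 0%N]).
  by apply: countable_setU cC _; apply: finite_set_countable; exact: finite_seq.
have [i ni Ki] := Kext (box_nonempty_K (ybox 0%N)) cCb.
pose z : Y := fun j => if j == 0%N then finite_point (i :: a 0%N) else y j.
have Uz : U z.
  apply: hU => j _; rewrite /z; case: eqP => [->|_]; last exact: ybox.
  apply: finite_point_box => // k; first by move=> ka; rewrite inE ka orbT.
  move=> kb; rewrite inE negb_or (box_disjoint (ybox 0%N) kb) andbT.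
  by apply/eqP => ki; apply: ni; right; rewrite /= -ki.
have [w [wC [wi _]]] : [set y : Y | forall i, chi (y 0%N) i -> C i] `&`
    [set w : Y | box [:: i] [::] (w 0%N)] !=set0.
  apply: (UC z Uz); apply: open_nbhs_nbhs; split.
    apply: (@open_comp _ _ (fun f : Y => f 0%N)) => [f _|]; last exact: box_open.
    exact: ptws_proj_continuous.
  by apply: finite_point_box => // k; rewrite !inE => ->.
by apply: ni; left; apply: wC; apply: wi; rewrite inE.
Qed.

End HomogeneousSpace.

Lemma not_MA_corson : ~ MA_aleph1_powerfully_ccc ->
  exists X : topologicalType, [/\ corson_compact X, ccc_space {ptws nat -> X},
    weight_aleph1 X,
    ~ (exists D : set {ptws nat -> X}, dense D /\ metrizable_subspace D) &
    [set: X] !=set0 /\ exists F : set (set {ptws nat -> X}),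
      card_le_aleph1 F /\ (forall A, F A -> nowhere_dense A) /\
      \bigcup_(A in F) A = [set: {ptws nat -> X}]].
Proof.
move=> /not_MA_family[I [r [K0 [[ri aI uI] [hK0 K01 pK0 Kc0]]]]].
have [K [hK Knil pK Kc Kext]] := frequent_subfamily uI hK0 K01 pK0 Kc0.
have cccY : ccc_space {ptws nat -> homogeneous_space K}.
  exact: homogeneous_power_ccc ri pK.
exists (homogeneous_space K); split=> //.
- exact: homogeneous_corson.
- exact: homogeneous_weight.
- move=> [D [dD mD]].
  have [S [cS dS]] := ccc_dense_metrizable_separable cccY dD mD.
  exact: homogeneous_power_not_separable dS.
split; first by exists (finite_point hK Knil [::]).
have [W [cW Ws]] := card_le_aleph1_small aI.
exists (range (fun d => [set y : {ptws nat -> homogeneous_space K} |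
  forall i, chi (y 0) i -> W d i])); split; first exact: card_le_aleph1_image.
split; first by move=> _ [d _ <-]; exact: homogeneous_power_nowhere_dense.
apply/seteqP; split=> // y _.
have [d Wd] := countable_cover_index uI Ws (countable_support Kc (y 0)).
exists [set z : {ptws nat -> homogeneous_space K} | forall i, chi (z 0) i -> W d i] => //.
Qed.

Theorem mainTheorem5 :
  let S1 := exists X : topologicalType,
      corson_compact X /\ ccc_space {ptws nat -> X} /\
      ~ (exists D : set {ptws nat -> X}, dense D /\ metrizable_subspace D) in
  let S2 := exists X : topologicalType,
      [set: X] !=set0 /\ compact [set: X] /\ hausdorff_space X /\
      ccc_space {ptws nat -> X} /\
      exists F : set (set {ptws nat -> X}),
        card_le_aleph1 F /\ (forall A, F A -> nowhere_dense A) /\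
        \bigcup_(A in F) A = [set: {ptws nat -> X}] in
  let S3 := ~ MA_aleph1_powerfully_ccc in
  let S4 := exists X : topologicalType,
      corson_compact X /\ ccc_space X /\ weight_aleph1 X /\
      ~ (exists D : set {ptws nat -> X}, dense D /\ metrizable_subspace D) in
  (S1 <-> S2) /\ (S2 <-> S3) /\ (S3 <-> S4).
Proof.
move=> S1 S2 S3 S4.
have S13 : S1 -> S3.
  move=> [X [corX [cccY nD]]] MA; apply: nD.
  exact: MA_dense_metrizable MA (corson_ptws_nat corX) (ptws_nat_powerfully_ccc cccY).
have S23 : S2 -> S3.
  move=> [X [[x _] [cX [hX [cccY [F [aF [ndF cov]]]]]]]] MA; move: cov.
  apply: (MA_not_covered MA _ _ (ptws_nat_powerfully_ccc cccY) _ aF ndF).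
  - exact: ptws_compact.
  - exact: ptws_hausdorff.
  - by exists (fun=> x).
have S43 : S4 -> S3.
  move=> [X [corX [cccX [[[B [aB bB]] n2] nD]]]] MA; apply: nD.
  have corY := corson_ptws_nat corX.
  (* [S4] only speaks of the ccc of [X]. If the power is ccc, the argument is that for [S1]; if not,
     the base of size aleph_1 supplies the sigma-disjoint pi-base. *)
  have [/ptws_nat_powerfully_ccc|nccc] := pselect (ccc_space {ptws nat -> X}).
    exact: MA_dense_metrizable.
  have uB : ~ countable B by move=> cB; apply: n2; exists B.
  have [V [oV dV bV]] := not_ccc_power_pi_base bB aB uB nccc.
  exact: dense_metrizable_pi_base corY oV dV bV.
have S3all : S3 -> [/\ S1, S2 & S4].
  move=> /not_MA_corson[X [corX cccY wX nD [X0 HF]]]; have [cX [hX _]] := corX.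
  split; [by exists X|by exists X|exists X].
  by split=> //; split=> //; exact: ccc_space_of_ptws_nat.
split; first by split=> [/S13|/S23] /S3all[].
by split; split=> // /S3all[].
Qed.
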